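(* Let $0 < \alpha \leq 2$. Let $X, X_1, X_2, \ldots$ be independent identically distributed real-valued random variables and $S_n = X_1 + \cdots + X_n$, $n \ge 1$. Then $$\limsup_{n \rightarrow \infty} \left| \frac{S_{n}}{n^{1/\alpha}} \right|^{(\log \log n)^{-1}} = e^{1/\alpha} \quad \text{almost surely}$$ if and only if $$\inf \left\{b \in \mathbb{R}:~ \mathbb{E} \left(\frac{|X|^{\alpha}}{(L|X|)^{b\alpha}} \right) < \infty \right\} = \frac{1}{\alpha}$$ and, in the case $1 < \alpha \leq 2$, additionally $\mathbb{E}X = 0$.
   Context: $\log$ is the natural logarithm and $Lx = \log(\max(e, x))$ for $x \ge 0$. The quantity $|\cdot|^{(\log\log n)^{-1}}$ is considered for $n \ge 3$. The infimum is taken in the extended reals over real $b$, with the infimum of the empty set equal to $+\infty$. The condition $\mathbb{E}X = 0$ includes that $\mathbb{E}X$ exists. *)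

(* Defs.v *)
From HB Require Import structures.
From mathcomp Require Import all_boot all_order all_algebra.
From mathcomp Require Import all_classical all_reals all_analysis.

Set Implicit Arguments.
Unset Strict Implicit.
Unset Printing Implicit Defensive.

Import Order.TTheory GRing.Theory Num.Theory.
Import numFieldNormedType.Exports.

Local Open Scope classical_set_scope.
Local Open Scope ring_scope.

(* Product rule over every finite subfamily: [uniq s] makes [s] a finite set of
   indices. *)
Definition mutually_independent (d : measure_display) (T : measurableType d)
    (R : realType) (P : probability T R) (I : eqType)
    (X : I -> {RV P >-> R}) : Prop :=
  forall (s : seq I) (A : I -> set R),
    uniq s -> (forall i, measurable (A i)) ->
    P (\bigcap_(i in [set` s]) (X i @^-1` A i)) =
    (\prod_(i <- s) P (X i @^-1` A i))%E.

(* The laws are compared on measurable sets only: equality of [distribution] as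
   functions on all of [set R] would also constrain the unspecified values of
   [P] on non-measurable sets. *)
Definition identically_distributed (d : measure_display)
    (T : measurableType d) (R : realType) (P : probability T R) (I : Type)
    (X : I -> {RV P >-> R}) : Prop :=
  forall (i j : I) (A : set R), measurable A ->
    distribution P (X i) A = distribution P (X j) A.

Definition iid (d : measure_display) (T : measurableType d) (R : realType)
    (P : probability T R) (I : eqType) (X : I -> {RV P >-> R}) : Prop :=
  mutually_independent X /\ identically_distributed X.

Definition Llog (R : realType) (x : R) : R := ln (Num.max (expR 1) x).

(* Term [0] of a sequence of random variables is kept apart, as a further copy
   of the common law: the partial sums run over the indices [1, ..., n]. *)
Definition partial_sum (d : measure_display) (T : measurableType d)
    (R : realType) (P : probability T R) (X : nat -> {RV P >-> R})
    (n : nat) (w : T) : R :=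
  \sum_(1 <= i < n.+1) X i w.

(* Main.v *)
Require Import Defs.
From HB Require Import structures.
From mathcomp Require Import all_boot all_order all_algebra.
From mathcomp Require Import all_classical all_reals all_analysis.
From mathcomp Require Import measurable_realfun.
From mathcomp Require Import lra ring.
Import Order.TTheory GRing.Theory Num.Theory.
Import numFieldNormedType.Exports.
Local Open Scope classical_set_scope.
Local Open Scope ring_scope.

(** The proof compares [|S_n|] with [n^(1/a) (ln n)^b]: for [ln n >= 2] the
    [n]-th term of the limit superior is at most [e^b] exactly when
    [|S_n| <= n^(1/a) (ln n)^b] ([rate_le]). With
    [phi a b x = x^a / (L x)^(b a)], everything follows from two
    statements, for [b > 0].

    - If [E phi(|X|) = +oo], then the limit superior is almost surely at least
      [e^b] ([limn_esup_lower_bound]). The tail probabilities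
      [P(phi(|X_n|) > n)] have a divergent sum, so infinitely many summands are
      at least of the order [n^(1/a) (ln n)^b], and such a summand cannot be hidden: it is
      the difference of two consecutive partial sums.

    - If [E phi(|X|) < +oo], and [c] is [E X] for [a > 1] and [0] for [a <= 1],
      then almost surely [|S_n - n c| <= n^(1/a) (ln n)^(b + e)] eventually,
      for every [e > 0] ([partial_sum_upper_bound]).

    For the second statement, consider the indices up to [2^(k+1)] and truncate
    the summands by the event [phi(|X|) <= 2^k]. Since [phi(x) <= z] implies
    [x <= M] for a scale [M] of order [z^(1/a) (L z)^b], and then
    [(x / M)^p <= phi(x) / z] for every [p >= a] ([scale_exists]), the
    truncated summand divided by [M] is bounded by [1] and has second moment
    [O(2^-k)]; for [a <= 1] the same holds of its first moment, and for [a > 1]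
    its mean differs from [E X / M] by [O(2^-k)]. Hence its centred exponential
    moment is [exp(O(2^-k))] ([mgf_truncation_le]), the exponential moment of
    the sum of [2^(k+1)] of them stays bounded in [k], and a maximal inequality
    ([maximal_inequality]) makes the probability that the walk leaves
    [[-2 M ln (k+1), 2 M ln (k+1)]] of order [k^-2]. The exponential moments
    treat all [a] in [(0, 2]] alike, and they are what makes these probabilities
    summable: second moments would only give the order [(ln k)^-2].

    The criterion is then monotonicity in [b]. If the moments are finite for
    [b > 1/a] and infinite for [b < 1/a], the two statements pin the limit
    superior down to [e^(1/a)]. Conversely, an infinite moment for some
    [b > 1/a] would make it too large; a nonzero mean for [a > 1] would make
    [S_n] grow linearly ([near_drift_eq0]); and, once the mean is known to
    vanish, a finite moment for some [b < 1/a] would make it too small. *)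

Set Implicit Arguments.
Unset Strict Implicit.
Unset Printing Implicit Defensive.

(** * Powers of the logarithm and the scale of the walk *)

Section Scale.
Context {R : realType}.
Implicit Types a b e p r x y z : R.

Let e_ge1 : 1 <= expR 1 :> R.
Proof. by rewrite -[leLHS]expR0 ler_expR. Qed.

Lemma Llog_ge1 x : 1 <= Llog x.
Proof.
rewrite /Llog -{1}(expRK (1 : R)) ler_ln ?posrE ?expR_gt0 ?lt_max ?expR_gt0//.
by rewrite le_max lexx.
Qed.

Lemma Llog_gt0 x : 0 < Llog x.
Proof. exact: lt_le_trans ltr01 (Llog_ge1 x). Qed.

Lemma Llog_ge0 x : 0 <= Llog x.
Proof. exact: ltW (Llog_gt0 x). Qed.

Lemma le_Llog x y : x <= y -> Llog x <= Llog y.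
Proof.
move=> xy; rewrite /Llog ler_ln ?posrE ?lt_max ?expR_gt0//.
by rewrite ge_max !le_max lexx xy orbT.
Qed.

Lemma ln_le_Llog x : ln x <= Llog x.
Proof.
have [x0|x0] := leP x 0; first by rewrite ln0// ltW// Llog_gt0.
by rewrite ler_ln ?posrE ?lt_max ?expR_gt0// le_max lexx orbT.
Qed.

Lemma Llog_ge_expR1 x : expR 1 <= x -> Llog x = ln x.
Proof. by move=> ex; rewrite /Llog max_r. Qed.

Lemma Llog_le_expR1 x : x <= expR 1 -> Llog x = 1.
Proof. by move=> ex; rewrite /Llog max_l// expRK. Qed.

Lemma Llog_mul x y : 0 <= x -> 0 <= y -> Llog (x * y) <= 2 * (Llog x * Llog y).
Proof.
move=> x0 y0.
have e1 := e_ge1.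
have e0 : 0 < expR 1 :> R by exact: expR_gt0.
have h : Llog (x * y) <= Llog x + Llog y.
  rewrite /Llog -lnM ?posrE ?lt_max ?e0// ler_ln ?posrE ?mulr_gt0 ?lt_max ?e0//.
  rewrite ge_max; apply/andP; split.
    by rewrite -[leLHS]mulr1; apply: ler_pM; rewrite ?expR_ge0 ?le_max ?lexx ?e1.

  by apply: ler_pM => //; rewrite le_max lexx orbT.
apply: le_trans h _; rewrite -subr_ge0.
have -> : 2 * (Llog x * Llog y) - (Llog x + Llog y) =
  Llog x * (Llog y - 1) + Llog y * (Llog x - 1) by ring.
by rewrite addr_ge0// mulr_ge0 ?Llog_ge0// subr_ge0 Llog_ge1.
Qed.

Lemma powR_div x y p : 0 <= x -> 0 < y -> (x / y) `^ p = x `^ p / y `^ p.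
Proof.
move=> x0 y0; rewrite powRM ?invr_ge0 ?(ltW y0)//; congr (_ * _).
by rewrite -powR_inv1 ?(ltW y0)// -powRrM mulN1r powRN.
Qed.

Lemma powRVK x p : 0 < p -> 0 <= x -> (x `^ p^-1) `^ p = x.
Proof. by move=> p0 x0; rewrite -powRrM mulVf ?gt_eqF// powRr1. Qed.

Lemma powRKV x p : 0 < p -> 0 <= x -> (x `^ p) `^ p^-1 = x.
Proof. by move=> p0 x0; rewrite -powRrM mulfV ?gt_eqF// powRr1. Qed.

Lemma powR_le1_le1 x p : 0 < p -> 0 <= x -> x `^ p <= 1 -> x <= 1.
Proof.
move=> p0 x0 xp; rewrite -(powRKV p0 x0).
apply: (@le_trans _ _ (1 `^ p^-1)); last by rewrite powR1.
by rewrite ge0_ler_powR ?invr_ge0 ?(ltW p0) ?nnegrE ?powR_ge0.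
Qed.

Lemma ln_le_powR x e : 0 < e -> 0 < x -> ln x <= x `^ e / e.
Proof.
move=> e0 x0; rewrite ler_pdivlMr// mulrC -ln_powR ltW// ln_sublinear//.
exact: powR_gt0.
Qed.

(** Bound the logarithm by a power with exponent [e / (b + 1)] and raise the
    result to the power [b + 1]. *)
Lemma Llog_powR_le b e : 0 <= b -> 0 < e ->
  exists2 C, 0 < C & forall r, 1 <= r -> Llog r `^ b <= C * r `^ e.
Proof.
move=> b0 e0; have b1 : 0 < b + 1 by lra.
have [h h0 hb] : exists2 h, 0 < h & h * (b + 1) = e.
  (* The exponent is divided by [b + 1] rather than [b], which may vanish. *)
  by exists (e / (b + 1)); rewrite ?divr_gt0// mulfVK ?gt_eqF.
exists ((expR 1 `^ h / h) `^ (b + 1)).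
  by rewrite powR_gt0 // divr_gt0 // powR_gt0 // expR_gt0.
move=> r r1; have r0 : 0 < r by lra.
apply: (@le_trans _ _ (Llog r `^ (b + 1))).
  by rewrite ler_powR ?Llog_ge1// lerDl.
rewrite -hb powRrM -powRM ?powR_ge0 ?divr_ge0 ?powR_ge0 ?(ltW h0)//.
rewrite ge0_ler_powR ?(ltW b1)// ?nnegrE ?mulr_ge0 ?divr_ge0 ?invr_ge0 ?powR_ge0 ?Llog_ge0 ?(ltW h0)//.
have m0 : 0 < Num.max (expR 1) r by rewrite lt_max r0 orbT.
apply: (le_trans (ln_le_powR h0 m0)).
rewrite mulrAC ler_pM2r ?invr_gt0// -powRM ?expR_ge0 ?(ltW r0)//.
rewrite ge0_ler_powR ?nnegrE ?mulr_ge0 ?expR_ge0 ?(ltW m0) ?(ltW h0) ?(ltW r0)//.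
have e1 := e_ge1.
by rewrite ge_max; apply/andP; split; nra.
Qed.

(** The condition of the theorem is the finiteness of [E phi(|X|)]. *)
Definition phi a b x : R := x `^ a / Llog x `^ (b * a).

Lemma phi_ge0 a b x : 0 <= phi a b x.
Proof. by rewrite divr_ge0 ?powR_ge0. Qed.

Lemma powR_phi a b x : x `^ a = phi a b x * Llog x `^ (b * a).
Proof. by rewrite /phi mulfVK// gt_eqF// powR_gt0// Llog_gt0. Qed.

(** An inverse of [phi a b], implicit through [Llog x]; the next lemma makes it
    explicit by replacing [Llog x] with [Llog (phi a b x)]. *)
Lemma phi_invE a b x : 0 < a -> 0 <= x ->
  x = phi a b x `^ a^-1 * Llog x `^ b.
Proof.
move=> a0 x0; rewrite -[LHS]powRr1// -(mulfV (lt0r_neq0 a0)) powRrM.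
rewrite (powR_phi a b) powRM ?phi_ge0 ?powR_ge0// -powRrM -mulrA.
by rewrite mulfV ?gt_eqF// mulr1.
Qed.

Lemma le_phi a b b' x : 0 < a -> b <= b' -> phi a b' x <= phi a b x.
Proof.
move=> a0 bb; rewrite /phi ler_wpM2l ?powR_ge0// lef_pV2 ?posrE ?powR_gt0 ?Llog_gt0//.
by rewrite ler_powR ?Llog_ge1// ler_wpM2r// ltW.
Qed.

(** Since [(L x)^(b a)] is dominated by [x^(a/2)], [phi a b x] is at least a
    constant times [x^(a/2)], so its logarithm is comparable to that of [x]. *)
Lemma Llog_le_Llog_phi a b : 0 < a -> 0 <= b ->
  exists2 C, 1 <= C & forall x, 0 <= x -> Llog x <= C * Llog (phi a b x).
Proof.
move=> a0 b0; have ba0 : 0 <= b * a by rewrite mulr_ge0// (ltW a0).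
have a20 : 0 < a / 2 by rewrite divr_gt0.
have [C0 C00 hC0] := @Llog_powR_le (b * a) (a / 2) ba0 a20.
exists (4 / a * Llog C0 + 1) => [|x x0].
  by rewrite lerDr mulr_ge0 ?divr_ge0 ?Llog_ge0 ?(ltW a0).
have L0 := Llog_ge1 (phi a b x).
have c0 : 0 <= 4 / a * Llog C0 by rewrite mulr_ge0 ?divr_ge0 ?Llog_ge0 ?(ltW a0).
have [xe|ex] := leP x (expR 1).
  rewrite Llog_le_expR1// -[leLHS]mulr1; apply: ler_pM => //.
  by rewrite lerDr.
have x1 : 1 <= x by apply: le_trans (ltW ex).
have xgt0 : 0 < x by lra.
rewrite Llog_ge_expR1 ?(ltW ex)//.
have h1 : x `^ (a / 2) <= C0 * phi a b x.
  rewrite /phi mulrA ler_pdivlMr ?powR_gt0 ?Llog_gt0//.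
  apply: (@le_trans _ _ (x `^ (a / 2) * (C0 * x `^ (a / 2)))).
    by rewrite ler_wpM2l ?powR_ge0 ?hC0.
  rewrite mulrCA ler_wpM2l ?(ltW C00)// -powRD; last by rewrite (gt_eqF xgt0) implybT.
  by rewrite -splitr lexx.
have h2 : a / 2 * ln x <= Llog (C0 * phi a b x).
  rewrite -ln_powR (le_trans _ (ln_le_Llog _))// ler_ln ?posrE ?powR_gt0//.
  by apply: lt_le_trans h1; rewrite powR_gt0.
have h3 := le_trans h2 (Llog_mul (ltW C00) (phi_ge0 a b x)).
have -> : ln x = 2 / a * (a / 2 * ln x) by field; rewrite gt_eqF.
apply: (@le_trans _ _ (2 / a * (2 * (Llog C0 * Llog (phi a b x))))).
  by rewrite ler_wpM2l// divr_ge0 ?(ltW a0).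
have -> : 2 / a * (2 * (Llog C0 * Llog (phi a b x))) = 4 / a * Llog C0 * Llog (phi a b x).
  by field; rewrite gt_eqF.
by rewrite ler_wpM2r ?lerDl ?Llog_ge0.
Qed.

(** The order of magnitude of the [x] at which [phi a b x] reaches [z]. *)
Definition scale a b (K : R) z : R := K * z `^ a^-1 * Llog z `^ b.

Lemma scale_gt0 a b K z : 0 < K -> 0 < z -> 0 < scale a b K z.
Proof. by move=> K0 z0; rewrite !mulr_gt0 ?powR_gt0 ?Llog_gt0. Qed.

(** With [y = phi a b x] one has [x = y^(1/a) (L x)^b] and [L x <= C L y], so
    [x / scale z] is at most [(y / z)^(1/a) (L y / L z)^b]. If [y <= z], the
    second factor is at most [1]; if [z <= y] and [1 < a], it is absorbed by
    the spare power [(y / z)^(1 - 1/a)]. The first bound controls all moments of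
    order at least [a] of the truncated variable, the second one the bias that
    truncation causes in the mean. *)
Lemma scale_exists a b : 0 < a -> 0 <= b ->
  exists2 K, 0 < K &
    (forall x z, 0 <= x -> 0 < z -> phi a b x <= z ->
       (x / scale a b K z) `^ a <= phi a b x / z) /\
    (1 < a -> exists2 C, 0 < C &
       forall x z, 0 <= x -> 0 < z -> z <= phi a b x ->
         x / scale a b K z <= C * (phi a b x / z)).
Proof.
move=> a0 b0; have [C C1 hC] := @Llog_le_Llog_phi a b a0 b0.
have C0 : 0 < C by lra.
exists (C `^ b); first by rewrite powR_gt0.
have key x z : 0 <= x -> 0 < z -> x / scale a b (C `^ b) z =
    (phi a b x / z) `^ a^-1 * (Llog x / (C * Llog z)) `^ b.
  move=> x0 z0; rewrite {1}(@phi_invE a b x)// /scale.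
  have CL : 0 < C * Llog z by rewrite mulr_gt0 ?Llog_gt0.
  rewrite (powR_div _ (phi_ge0 a b x) z0) (powR_div _ (Llog_ge0 x) CL).
  rewrite (powRM b (ltW C0) (Llog_ge0 z)).
  by rewrite mulf_div; congr (_ / _); rewrite mulrCA mulrA.
split => [x z x0 z0 xz|a1].
- rewrite key// (powRM _ (powR_ge0 _ _) (powR_ge0 _ _)) -!powRrM mulVf ?gt_eqF//.
  rewrite powRr1; last exact: divr_ge0 (phi_ge0 a b x) (ltW z0).
  apply: ler_piMr; first by rewrite divr_ge0 ?phi_ge0 ?(ltW z0).
  have ba0 : 0 <= b * a by rewrite mulr_ge0// (ltW a0).
  apply: (@le_trans _ _ (1 `^ (b * a))); last by rewrite powR1.
  rewrite ge0_ler_powR// ?nnegrE ?divr_ge0 ?mulr_ge0 ?Llog_ge0 ?(ltW C0)//.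
  rewrite ler_pdivrMr ?mulr_gt0 ?Llog_gt0// mul1r.
  apply: (le_trans (hC x x0)); apply: ler_wpM2l; first exact: ltW.
  exact: le_Llog.
- have e0 : 0 < 1 - a^-1 by rewrite subr_gt0 invf_lt1.
  have [D D0 hD] := Llog_powR_le b0 e0.
  exists (2 `^ b * D) => [|x z x0 z0 zx]; first by rewrite mulr_gt0 ?powR_gt0.
  have r1 : 1 <= phi a b x / z by rewrite ler_pdivlMr ?mul1r.
  rewrite key//; set r := phi a b x / z in r1 *.
  have r0 : 0 < r by lra.
  apply: (@le_trans _ _ (r `^ a^-1 * (2 * Llog r) `^ b)).
    rewrite ler_wpM2l ?powR_ge0// ge0_ler_powR// ?nnegrE ?divr_ge0 ?mulr_ge0 ?Llog_ge0 ?(ltW C0)//.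
    rewrite ler_pdivrMr ?mulr_gt0 ?Llog_gt0// (le_trans (hC x x0))//.
    rewrite [leRHS](_ : _ = C * (2 * (Llog r * Llog z))); last by ring.
    rewrite ler_wpM2l ?(ltW C0)// (_ : phi a b x = r * z) ?Llog_mul ?(ltW z0) ?(ltW r0)//.
    by rewrite /r mulfVK ?gt_eqF.
  rewrite powRM ?Llog_ge0// mulrCA -mulrA ler_wpM2l ?powR_ge0//.
  apply: (@le_trans _ _ (r `^ a^-1 * (D * r `^ (1 - a^-1)))).
    by rewrite ler_wpM2l ?powR_ge0 ?hD.
  rewrite mulrCA ler_wpM2l ?(ltW D0)// -powRD; last by rewrite (gt_eqF r0) implybT.
  by rewrite addrC subrK powRr1 ?(ltW r0).
Qed.

End Scale.

(** * Exponential bound for a truncated variable *)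

Section Truncation.
Context {R : realType}.
Implicit Types a b x z s u : R.

(** The square of an estimate at [v = u / 2], where [e^v <= 1 / (1 - v)] is
    sharp enough because [v] stays away from [1]. *)
Lemma expR_le_quad u : `|u| <= 1 -> expR u <= 1 + u + 2 * u ^+ 2.
Proof.
rewrite ler_norml => /andP[u1 u2]; pose v := u / 2.
have uE : u = v + v by rewrite /v -splitr.
have v1 : - 1 <= 2 * v by rewrite /v mulrCA divff// mulr1.
have v2 : 2 * v <= 1 by rewrite /v mulrCA divff// mulr1.
have ev : expR v <= 1 + v + 2 * v ^+ 2.
  have h : expR v * (1 - v) <= 1.
    rewrite -[leRHS](expRxMexpNx_1 v) ler_wpM2l ?expR_ge0//.
    by rewrite (le_trans _ (expR_ge1Dx _)).
  have h2 : 1 <= (1 + v + 2 * v ^+ 2) * (1 - v).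
    have -> : (1 + v + 2 * v ^+ 2) * (1 - v) = 1 + v ^+ 2 * (1 - 2 * v) by ring.
    by rewrite lerDl mulr_ge0 ?sqr_ge0 ?subr_ge0.
  have v10 : 0 < 1 - v by lra.
  by rewrite -(ler_pM2r v10) (le_trans h).
rewrite {1}uE expRD.
apply: (@le_trans _ _ ((1 + v + 2 * v ^+ 2) * (1 + v + 2 * v ^+ 2))).
  by apply: ler_pM; rewrite ?expR_ge0.
rewrite uE -subr_ge0.
have -> : 1 + (v + v) + 2 * (v + v) ^+ 2 - (1 + v + 2 * v ^+ 2) * (1 + v + 2 * v ^+ 2) =
  v ^+ 2 * ((1 - 2 * v) * (3 + 2 * v)) by ring.
rewrite mulr_ge0 ?sqr_ge0// mulr_ge0//; lra.
Qed.

Definition truncation a b (K : R) z x : R :=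
  if phi a b `|x| <= z then x / scale a b K z else 0.

(** The part of the summand that has to be centred. For [a <= 1] the truncated
    means of a block add up to the order of the scale only, so that nothing is
    subtracted. *)
Definition linear_part a x : R := if 1 < a then x else 0.

(** For [u = s x / M] with [|u| <= 1] the quadratic and, when [a <= 1], also the
    linear term of the exponential are absorbed by [phi / z]. Where the
    variable is truncated to [0] the exponential is [1], and for [1 < a] the linear term that is put
    back is again at most a multiple of [phi / z]. Having the untruncated linear
    term on the right makes the mean of [X] itself appear upon integration. *)
Lemma expR_truncation_le a b : 0 < a -> a <= 2 -> 0 <= b ->
  exists2 K, 0 < K & exists2 C, 0 <= C & forall s x z, `|s| = 1 -> 0 < z ->
    expR (s * truncation a b K z x) <=
    1 + s * (linear_part a x / scale a b K z) + C * (phi a b `|x| / z).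
Proof.
move=> a0 a2 b0; have [K K0 [h1 h2]] := scale_exists a0 b0; exists K => //.
have [C2 C20 hC2] : exists2 C2, 0 <= C2 & 1 < a -> forall x z, 0 <= x -> 0 < z ->
    z <= phi a b x -> x / scale a b K z <= C2 * (phi a b x / z).
  have [a1|a1] := leP a 1; first by exists 0 => //; rewrite ltNge a1.
  by have [C C0 hC] := h2 a1; exists C => [|_]; [exact: ltW|].
exists (3 + C2); first by lra.
move=> s x z s1 z0; have M0 := scale_gt0 a b K0 z0.
set M := scale a b K z in h1 hC2 M0 *.
set y := phi a b `|x| / z.
have y0 : 0 <= y by rewrite divr_ge0 ?phi_ge0 ?ltW.
have Cy : 0 <= C2 * y by rewrite mulr_ge0.
rewrite /truncation /linear_part -/M; case: ifPn => xz.
- have hy : (`|x| / M) `^ a <= y by exact: h1.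
  have xM0 : 0 <= `|x| / M by rewrite divr_ge0 ?(ltW M0).
  have xM1 : `|x| / M <= 1.
    apply: powR_le1_le1 a0 xM0 (le_trans hy _).
    by rewrite /y ler_pdivrMr// mul1r.
  have uE : `|s * (x / M)| = `|x| / M by rewrite normrM s1 mul1r normrM normfV (gtr0_norm M0).
  have pw p : a <= p -> (`|x| / M) `^ p <= y.
    move=> ap; apply: le_trans hy; have [->|xN0] := eqVneq (`|x| / M) 0.
      by rewrite !powR0 ?gt_eqF// (lt_le_trans a0).
    by apply: ger_powR => //; rewrite xM1 andbT lt0r xN0.
  have u2 : (s * (x / M)) ^+ 2 <= y.
    by rewrite -real_normK ?num_real// uE -powR_mulrn// pw.
  have := @expR_le_quad (s * (x / M)); rewrite uE => /(_ xM1) h.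
  apply: (le_trans h); case: ifPn => a1; first by lra.
  have u1 : s * (x / M) <= y.
    apply: (le_trans (ler_norm _)); rewrite uE -[leLHS]powRr1//; apply: pw.
    by rewrite leNgt.
  by rewrite mul0r mulr0 addr0; lra.
- rewrite mulr0 expR0; case: ifPn => a1; last by rewrite mul0r mulr0 addr0; lra.
  have := hC2 a1 `|x| z (normr_ge0 _) z0; rewrite -/y => /(_ _).
  have -> : z <= phi a b `|x| by rewrite ltW// ltNge.
  move=> /(_ isT) hx.
  have : - (`|x| / M) <= s * (x / M).
    have -> : `|x| / M = `|s * (x / M)| by rewrite normrM s1 mul1r normrM normfV (gtr0_norm M0).
    by rewrite lerNl -normrN ler_norm.
  lra.
Qed.

End Truncation.

(** * Deterministic asymptotics of sequences *)

Section Asymptotics.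
Context {R : realType}.
Implicit Types a b e A : R.

Lemma near_ln_ge A : \forall n \near \oo, A <= ln (n%:R : R).
Proof.
near=> n; rewrite -[leLHS]expRK ler_ln ?posrE ?expR_gt0//.
  by near: n; exact: nbhs_infty_ger.
by rewrite ltr0n; near: n; exact: nbhs_infty_gt.
Unshelve. all: by end_near. Qed.

Lemma near_ln_powR_ge e A : 0 < e -> \forall n \near \oo, A <= ln (n%:R : R) `^ e.
Proof.
move=> e0; near=> n.
have l1 : 1 <= ln (n%:R : R) by near: n; exact: near_ln_ge.
have h : `|A| `^ e^-1 <= ln (n%:R : R) by near: n; exact: near_ln_ge.
apply: (le_trans (ler_norm _)); rewrite -(powRVK e0 (normr_ge0 A)).
by rewrite ge0_ler_powR ?(ltW e0) ?nnegrE ?powR_ge0 ?(le_trans ler01 l1).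
Unshelve. all: by end_near. Qed.

Section Rate.
Variables (a : R) (S : nat -> R).

(** The sequence whose limit superior the theorem is about. *)
Definition rate (n : nat) : R :=
  `| S n / n%:R `^ a^-1 | `^ (ln (ln n%:R))^-1.

Lemma rate_le n b : 2 <= ln (n%:R : R) ->
  (rate n <= expR b) = (`|S n| <= n%:R `^ a^-1 * ln n%:R `^ b).
Proof.
move=> l2; have l0 : 0 < ln (n%:R : R) by lra.
have n0 : 0 < (n%:R : R).
  by rewrite ltNge; apply/negP => /ln0 h; move: l0; rewrite h ltxx.
have ll0 : 0 < ln (ln (n%:R : R)) by rewrite ln_gt0//; lra.
have lb : expR b = (ln n%:R `^ b) `^ (ln (ln (n%:R : R)))^-1.
  by rewrite -powRrM /powR gt_eqF// -mulrA mulVf ?mulr1// gt_eqF.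
rewrite /rate lb [X in _ = (_ <= X)]mulrC -ler_pdivrMr ?powR_gt0//.
rewrite normrM normfV (ger0_norm (powR_ge0 _ _)).
apply/idP/idP => h; last first.
  by rewrite ge0_ler_powR ?invr_ge0 ?(ltW ll0) ?nnegrE ?powR_ge0 ?divr_ge0.
rewrite leNgt; apply/negP => /(gt0_ltr_powR _) => /(_ (ln (ln n%:R))^-1).
rewrite invr_gt0 !nnegrE ll0 powR_ge0 divr_ge0 ?powR_ge0// => /(_ isT isT isT).
by rewrite ltNge h.
Qed.

Lemma limn_esup_rate_le b :
  (\forall n \near \oo, `|S n| <= n%:R `^ a^-1 * ln n%:R `^ b) ->
  (limn_esup (fun n => (rate n)%:E) <= (expR b)%:E)%E.
Proof.
move=> h; pose V := [set n | rate n <= expR b].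
apply: (@le_trans _ _ (ereal_sup ((fun n => (rate n)%:E) @` V))).
  apply: ereal_inf_lbound; exists V => //; rewrite /V.
  near=> n => /=; rewrite rate_le; first by near: n.
  by near: n; exact: near_ln_ge.
by apply: ge_ereal_sup => _ [n Vn <-]; rewrite lee_fin.
Unshelve. all: by end_near. Qed.

(** The exponent can be lowered because the supremum over some tail is still
    below [e^b]; the maximum with [0] covers a supremum of at most [1]. *)
Lemma limn_esup_rate_lt b : 0 < b ->
  (limn_esup (fun n => (rate n)%:E) < (expR b)%:E)%E ->
  exists2 b', 0 <= b' < b &
    \forall n \near \oo, `|S n| <= n%:R `^ a^-1 * ln n%:R `^ b'.
Proof.
move=> b0 /ereal_inf_lt[_ [V oV <-]] sb.
have hs n : V n -> ((rate n)%:E <= ereal_sup ((fun n => (rate n)%:E) @` V))%E.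
  by move=> Vn; apply: ereal_sup_ubound; exists n.
have [n0 Vn0] : exists n, V n by apply: (@filter_ex _ (\oo)).
have : (0%:E <= ereal_sup ((fun n => (rate n)%:E) @` V))%E.
  by apply: le_trans (hs _ Vn0); rewrite lee_fin powR_ge0.
case: (ereal_sup _) sb hs => [s| |]//; rewrite lte_fin lee_fin => sb hs s0.
exists (Num.max 0 (ln s)).
  rewrite le_max lexx /= gt_max b0 /=.
  have [->|sn0] := eqVneq s 0; first by rewrite ln0.
  by rewrite -ltr_expR lnK// posrE lt0r sn0.
near=> n; rewrite -rate_le; last by near: n; exact: near_ln_ge.
have Vn : V n by near: n.
have := hs _ Vn; rewrite lee_fin => /le_trans; apply.
have [->|sn0] := eqVneq s 0; first by rewrite expR_ge0.
rewrite -[leLHS]lnK ?posrE ?lt0r ?sn0// ler_expR le_max lexx orbT//.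
Unshelve. all: by end_near. Qed.

End Rate.

(** If the limit superior were below [e^b], then [S n] and [S n.-1], hence also
    their difference [x n], would be [O(n^(1/a) (ln n)^b')] with [b' < b],
    whereas [n < phi a b |x n|] forces [|x n|] above
    [n^(1/a) (ln n / a)^b]. *)
Lemma limn_esup_rate_ge a b (S x : nat -> R) : 0 < a -> 0 < b ->
  (forall n, S n.+1 = S n + x n.+1) ->
  (forall m, exists2 n, (m <= n)%N & n%:R < phi a b `|x n|) ->
  ((expR b)%:E <= limn_esup (fun n => (rate a S n)%:E))%E.
Proof.
move=> a0 b0 Sx hx; rewrite leNgt; apply/negP => /(limn_esup_rate_lt b0).
move=> [b' /andP[b'0 b'b] hS].
have db : 0 < b - b' by rewrite subr_gt0.
have : \forall n \near \oo, [/\ `|S n| <= n%:R `^ a^-1 * ln n%:R `^ b',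
    1 <= ln (n%:R : R) & 2 * a `^ b <= ln (n%:R : R) `^ (b - b')].
  near=> n; split; near: n => //; first exact: near_ln_ge.
  exact: near_ln_powR_ge.
move=> [m _ hm]; have [[//|n] mn nx] := hx m.+1.
have [Sn ln1 _] := hm n mn.
have [Sn1 lnn1 big] := hm n.+1 (leqW mn).
set N : R := n.+1%:R in nx Sn1 lnn1 big.
have N0 : 0 < N by rewrite ltr0n.
have nN : (n%:R : R) <= N by rewrite ler_nat.
have lN0 : 0 < ln N by lra.
have nn0 : 0 < (n%:R : R).
  by rewrite ltNge; apply/negP => /ln0 h; move: ln1; rewrite h ler10.
have lnN : ln (n%:R : R) <= ln N by rewrite ler_ln ?posrE.
have x_le : `|x n.+1| <= 2 * (N `^ a^-1 * ln N `^ b').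
  have -> : x n.+1 = S n.+1 - S n by rewrite Sx addrC addKr.
  apply: (le_trans (ler_normB _ _)); rewrite mulr2n mulrDl mul1r lerD//.
  apply: (le_trans Sn); apply: ler_pM; rewrite ?powR_ge0//.
    by rewrite ge0_ler_powR ?invr_ge0 ?(ltW a0) ?nnegrE ?(ltW nn0) ?(ltW N0).
  by rewrite ge0_ler_powR ?nnegrE ?(le_trans ler01 ln1) ?(ltW lN0).
set u := `|x n.+1| in nx x_le.
have u0 : 0 <= u by exact: normr_ge0.
have uN : N `^ a^-1 < u.
  have h1 : N < u `^ a.
    rewrite (powR_phi a b) (lt_le_trans nx)// ler_peMr ?phi_ge0//.
    rewrite -[leLHS](powRr0 (Llog u)) ler_powR ?Llog_ge1// mulr_ge0 ?ltW//.
  rewrite -[ltRHS](powRKV a0 u0).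
  by rewrite gt0_ltr_powR ?invr_gt0 ?nnegrE ?powR_ge0 ?(ltW N0).
have lu : ln N / a <= Llog u.
  apply: le_trans (ln_le_Llog _); rewrite mulrC -ln_powR.
  by rewrite ler_ln ?posrE ?powR_gt0 ?(ltW uN)// (le_lt_trans _ uN) ?powR_ge0.
have : N `^ a^-1 * (ln N / a) `^ b < u.
  rewrite [ltRHS](phi_invE b a0 u0).
  apply: (@lt_le_trans _ _ (phi a b u `^ a^-1 * (ln N / a) `^ b)).
    rewrite ltr_pM2r ?powR_gt0 ?divr_gt0//.
    by rewrite gt0_ltr_powR ?invr_gt0 ?nnegrE ?phi_ge0 ?(ltW N0).
  rewrite ler_wpM2l ?powR_ge0// ge0_ler_powR ?(ltW b0) ?nnegrE ?Llog_ge0//.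
  by rewrite divr_ge0 ?(ltW lN0) ?(ltW a0).
rewrite ltNge => /negP; apply; apply: (le_trans x_le).
rewrite mulrCA ler_wpM2l ?powR_ge0//.
rewrite powR_div ?(ltW lN0)// ler_pdivlMr ?powR_gt0// mulrAC.
apply: (@le_trans _ _ (ln N `^ (b - b') * ln N `^ b')).
  by rewrite ler_wpM2r ?powR_ge0.
by rewrite -powRD ?(gt_eqF lN0) ?implybT// subrK.
Unshelve. all: by end_near. Qed.

(** Every [n] lies in the block of [k = trunc_log 2 n], for which
    [k = O(ln n)]. One half of the spare power [e] pays for the factor
    [ln k.+1], the other half for the constants. *)
Lemma near_block_bound a b K e (S : nat -> R) : 0 < a -> 0 <= b -> 0 < K -> 0 < e ->
  (\forall k \near \oo, forall j, (0 < j <= 2 ^ k.+1)%N ->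
     `|S j| <= scale a b K (2 ^+ k) * (2 * ln k.+1%:R)) ->
  \forall n \near \oo, `|S n| <= n%:R `^ a^-1 * ln n%:R `^ (b + e).
Proof.
move=> a0 b0 K0 e0 [k0 _ hk].
have ln2 : 0 < ln (2 : R) by rewrite ln_gt0// ltr1n.
have e20 : 0 < e / 2 by rewrite divr_gt0.
pose D : R := (ln 2)^-1 + 1.
have D0 : 0 < D by rewrite addr_gt0 ?invr_gt0.
pose B : R := K * (2 * (D `^ (e / 2) / (e / 2))).
near=> n.
have nk0 : (2 ^ k0.+1 <= n)%N by near: n; exact: nbhs_infty_ge.
have l1 : 1 <= ln (n%:R : R) by near: n; exact: near_ln_ge.
have hB : B <= ln (n%:R : R) `^ (e / 2) by near: n; exact: near_ln_powR_ge.
have n0 : (0 < n)%N by rewrite (leq_trans _ nk0)// expn_gt0.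
have nR0 : 0 < (n%:R : R) by rewrite ltr0n.
pose k := trunc_log 2 n.
have /andP[kn nk] : (2 ^ k <= n < 2 ^ k.+1)%N by exact: trunc_log_bounds.
have k0k : (k0 <= k)%N.
  by have := leq_ltn_trans nk0 nk; rewrite ltn_exp2l// !ltnS => /ltnW.
have knR : (2 : R) ^+ k <= n%:R by rewrite -natrX ler_nat.
have z0 : 0 < (2 : R) ^+ k by rewrite exprn_gt0.
have lnn0 : 0 <= ln (n%:R : R) by lra.
have kln : k.+1%:R <= D * ln n%:R.
  have h : k%:R * ln 2 <= ln (n%:R : R).
    by rewrite -(ln_powR 2) powR_mulrn// ler_ln ?posrE.
  rewrite -natr1 /D mulrDl mul1r lerD// mulrC -ler_pdivrMr ?invr_gt0//.
  by rewrite invrK.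
have -> : ln (n%:R : R) `^ (b + e) = ln n%:R `^ b * ln n%:R `^ (e / 2) * ln n%:R `^ (e / 2).
  by rewrite -!powRD ?(gt_eqF (lt_le_trans ltr01 l1)) ?implybT// -addrA -splitr.
have Sn : `|S n| <= scale a b K (2 ^+ k) * (2 * ln k.+1%:R).
  by apply: (hk k k0k); rewrite n0 ltnW.
apply: (le_trans Sn).
have h1 : scale a b K (2 ^+ k) <= K * (n%:R `^ a^-1 * ln n%:R `^ b).
  rewrite /scale -mulrA ler_wpM2l ?(ltW K0)//.
  apply: ler_pM; rewrite ?powR_ge0//.
    by rewrite ge0_ler_powR ?invr_ge0 ?(ltW a0) ?nnegrE ?(ltW z0) ?(ltW nR0).
  rewrite ge0_ler_powR ?nnegrE ?Llog_ge0//.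
  apply: (le_trans (le_Llog knR)); rewrite Llog_ge_expR1//.
  by rewrite -[leRHS]lnK ?posrE// ler_expR.
have h2 : ln (k.+1%:R : R) <= D `^ (e / 2) * ln n%:R `^ (e / 2) / (e / 2).
  apply: (le_trans (@ln_le_powR _ _ (e / 2) e20 _)); first by rewrite ltr0n.
  rewrite ler_pM2r ?invr_gt0// -powRM ?(ltW D0)//.
  by rewrite ge0_ler_powR ?(ltW e20) ?nnegrE ?mulr_ge0 ?(ltW D0).
have lk0 : 0 <= ln (k.+1%:R : R) by rewrite ln_ge0// ler1n.
apply: (@le_trans _ _ (K * (n%:R `^ a^-1 * ln n%:R `^ b) *
    (2 * (D `^ (e / 2) * ln n%:R `^ (e / 2) / (e / 2))))).
  apply: ler_pM => //; [exact: ltW (scale_gt0 _ _ K0 z0)|exact: mulr_ge0|].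
  by rewrite ler_wpM2l.
set N := n%:R `^ a^-1; set L := ln n%:R `^ b; set E := ln n%:R `^ (e / 2).
have -> : K * (N * L) * (2 * (D `^ (e / 2) * E / (e / 2))) = N * L * (B * E).
  by rewrite /B; ring.
have -> : N * (L * E * E) = N * L * (E * E) by ring.
rewrite ler_wpM2l ?mulr_ge0 ?powR_ge0//.
by rewrite ler_wpM2r ?powR_ge0.
Unshelve. all: by end_near. Qed.

(** The two bounds give [n |c| <= 2 n^(1/a) (ln n)^b], which is [o(n)]. *)
Lemma near_drift_eq0 a b (S : nat -> R) c : 1 < a -> 0 <= b ->
  (\forall n \near \oo, `|S n| <= n%:R `^ a^-1 * ln n%:R `^ b) ->
  (\forall n \near \oo, `|S n - n%:R * c| <= n%:R `^ a^-1 * ln n%:R `^ b) ->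
  c = 0.
Proof.
move=> a1 b0 h1 h2; apply/eqP; apply: contraT => c0.
have a0 : 0 < a by lra.
pose e : R := (1 - a^-1) / 2.
have e0 : 0 < e by rewrite divr_gt0// subr_gt0 invf_lt1.
have [C C0 hC] := Llog_powR_le b0 e0.
have cn0 : 0 < `|c| by rewrite normr_gt0.
have /filter_ex[n [H1 H2 n1 big]] : \forall n \near \oo,
    [/\ `|S n| <= n%:R `^ a^-1 * ln n%:R `^ b,
    `|S n - n%:R * c| <= n%:R `^ a^-1 * ln n%:R `^ b, (0 < n)%N &
     2 * C / `|c| < ln (n%:R : R) * e].
  near=> n; split; [by near: n|by near: n|by near: n; exact: nbhs_infty_gt|].
  rewrite -ltr_pdivrMr//.
  apply: (@lt_le_trans _ _ (2 * C / `|c| / e + 1)); first by rewrite ltrDl.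
  by near: n; exact: near_ln_ge.
have nR0 : 0 < (n%:R : R) by rewrite ltr0n.
have nR1 : 1 <= (n%:R : R) by rewrite ler1n.
have lb : ln (n%:R : R) `^ b <= C * n%:R `^ e.
  apply: le_trans (hC _ nR1); rewrite ge0_ler_powR ?nnegrE ?(ln_ge0 nR1) ?Llog_ge0//.
  exact: ln_le_Llog.
have nc : n%:R * `|c| <= n%:R `^ a^-1 * (2 * (C * n%:R `^ e)).
  have -> : n%:R * `|c| = `|S n - (S n - n%:R * c)|.
    by rewrite opprB addrC subrK normrM ger0_norm.
  apply: (le_trans (ler_normB _ _)); apply: (le_trans (lerD H1 H2)).
  set N := _ `^ a^-1; set L := _ `^ b.
  have -> : N * L + N * L = N * (2 * L) by ring.
  apply: ler_wpM2l; rewrite ?powR_ge0//.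
  exact: ler_wpM2l.
have nE : n%:R = n%:R `^ a^-1 * n%:R `^ e * n%:R `^ e :> R.
  rewrite -!powRD ?(lt0r_neq0 nR0) ?implybT//.
  have -> : a^-1 + e + e = 1 by rewrite /e; lra.
  by rewrite powRr1 ?ltW.
move: nc; rewrite {1}nE -!mulrA ler_pM2l ?powR_gt0//.
have -> : 2 * (C * n%:R `^ e) = n%:R `^ e * (2 * C) by ring.
rewrite ler_pM2l ?powR_gt0// -ler_pdivlMr// leNgt => /negP[].
apply: (lt_trans big); rewrite mulrC -ln_powR ln_sublinear// powR_gt0//.
Unshelve. all: by end_near. Qed.

End Asymptotics.

(** * Independence from the past *)

Section Independence.
Context {d : measure_display} {T : measurableType d} {R : realType}.
Variable P : probability T R.
Variable X : nat -> {RV P >-> R}.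
Hypothesis indepX : mutually_independent X.

(** Cylinder events of [X 1, ..., X j]: a pi-system that generates their
    sigma-algebra. *)
Definition past (j : nat) : set (set T) :=
  [set E | exists2 A : nat -> set R, (forall i, measurable (A i)) &
     E = \bigcap_(i in [set i | (0 < i <= j)%N]) (X i @^-1` A i)].

Let mX i A : measurable A -> measurable (X i @^-1` A).
Proof. by move=> mA; rewrite -[_ @^-1` _]setTI; exact: measurable_funP. Qed.

Lemma measurable_past j : past j `<=` measurable.
Proof.
by move=> _ [A mA ->]; apply: bigcap_measurableType => i _; exact: mX.
Qed.

Lemma setI_closed_past j : setI_closed (past j).
Proof.
move=> _ _ [A mA ->] [B mB ->]; exists (fun i => A i `&` B i).
  by move=> i; apply: measurableI.
by rewrite -bigcapI; apply: eq_bigcapr => i _; rewrite preimage_setI.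
Qed.

Lemma pastT j : past j setT.
Proof.
exists (fun=> setT) => //.
by apply/seteqP; split.
Qed.

Lemma sub_past j : past j `<=` past j.+1.
Proof.
move=> _ [A mA ->]; exists (fun i => if (i <= j)%N then A i else setT).
  by move=> i; case: ifP.
apply/seteqP; split => w h i /=.
  move=> /andP[i1 ij]; case: ifPn => // ij'.
  by apply: h; rewrite /= i1.
move=> /andP[i1 ij].
by have := h i; rewrite /= i1 ij; apply; exact: leqW.
Qed.

Lemma past_preimage j A : measurable A -> past j.+1 (X j.+1 @^-1` A).
Proof.
move=> mA; exists (fun i => if i == j.+1 then A else setT).
  by move=> i; case: ifP.
apply/seteqP; split => w h.
  by move=> i _; rewrite /=; case: eqP => // ->.
by have := h j.+1; rewrite /= eqxx; apply.
Qed.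

Lemma past_measurable j E : <<s past j >> E -> measurable E.
Proof.
by apply: smallest_sub; [exact: sigma_algebra_measurable|exact: measurable_past].
Qed.

(** Both sides are finite measures of [E]; they agree on the cylinders by mutual
    independence, hence on the sigma-algebra that the cylinders generate. *)
Lemma past_indep j E B : <<s past j >> E -> measurable B ->
  P (E `&` X j.+1 @^-1` B) = (P E * P (X j.+1 @^-1` B))%E.
Proof.
move=> sE mB; have mXB := mX j.+1 mB.
have pf : P (X j.+1 @^-1` B) \is a fin_num by exact: fin_num_measure.
have p0 : 0 <= fine (P (X j.+1 @^-1` B)) by rewrite fine_ge0.
pose m1 := mrestr P mXB.
pose m2 := mscale (NngNum p0) P.
have m2E G : m2 G = (P (X j.+1 @^-1` B) * P G)%E.
  by rewrite -[in RHS](fineK pf).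
have : m1 E = m2 E.
  apply: (@g_sigma_algebra_measure_unique _ _ _ (past j) _ (fun=> setT)) => //.
  - exact: measurable_past.
  - by move=> _; exact: pastT.
  - by rewrite bigcup_const.
  - exact: setI_closed_past.
  - move=> _ [A mA ->]; rewrite -[LHS]/(P (_ `&` _)) -[RHS]/(m2 _) m2E.
    pose A' i := if i == j.+1 then B else A i.
    have mA' i : measurable (A' i) by rewrite /A'; case: ifP.
    have Dj : [set i | (0 < i <= j)%N] = [set` iota 1 j].
      by apply/seteqP; split => i /=; rewrite mem_iota add1n ltnS.
    rewrite Dj; have -> : \bigcap_(i in [set` iota 1 j]) (X i @^-1` A i) `&` X j.+1 @^-1` B =
       \bigcap_(i in [set` j.+1 :: iota 1 j]) (X i @^-1` A' i).
      apply/seteqP; split => w.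
        move=> [h1 h2] i; rewrite /= inE => /orP[/eqP->|ij]; first by rewrite /A' eqxx.
        rewrite /A'; case: eqP => [->//|_]; exact: h1.
      move=> h; split.
        move=> i /= ij; have := h i; rewrite /= inE ij orbT => /(_ isT).
        rewrite /A'; case: eqP => // ej; move: ij.
        by rewrite ej mem_iota add1n ltnn andbF.
      by have := h j.+1; rewrite /= inE eqxx /A' eqxx; apply.
    have u : uniq (j.+1 :: iota 1 j).
      by rewrite /= iota_uniq mem_iota add1n ltnn andbF.
    rewrite (indepX u mA') big_cons (indepX _ mA) ?iota_uniq//.
    rewrite /A' eqxx; congr (_ * _)%E.
    rewrite !big_seq; apply: eq_bigr => i; rewrite mem_iota => /andP[_ ij].
    by case: eqP => // ej; move: ij; rewrite ej add1n ltnn.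
  - by move=> k; rewrite -[X in (X < _)%E]/(P (setT `&` _)) setTI (le_lt_trans (probability_le1 P mXB))// ltry.
by rewrite m2E muleC.
Qed.

(** Past and next summand are independent, so their joint law is the product of
    the laws and Tonelli's theorem applies. *)
Lemma past_fubini j (Z : {RV P >-> R}) (F : (R * R)%type -> \bar R) :
  (forall A, measurable A -> <<s past j >> (Z @^-1` A)) ->
  measurable_fun [set: (R * R)%type] F -> (forall zx, 0 <= F zx)%E ->
  (\int[P]_w F (Z w, X j.+1 w) =
   \int[distribution P Z]_z \int[distribution P (X j.+1)]_x F (z, x))%E.
Proof.
move=> adZ mF F0.
have mZX : measurable_fun setT (fun w => (Z w, X j.+1 w)).
  by apply/measurable_fun_pairP; split => /=; exact: measurable_funP.
pose ZX : {RV P >-> (R * R)%type} :=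
  HB.pack (fun w => (Z w, X j.+1 w)) (isMeasurableFun.Build _ _ _ _ _ mZX).
rewrite -(fubini_tonelli1 F mF F0).
rewrite (@eq_measure_integral _ _ _ _ (distribution P ZX)).
  by rewrite ge0_integral_distribution.
move=> A mA _; apply: product_measure_unique => // B C mB mC.
exact: past_indep (adZ _ mB) mC.
Qed.

End Independence.

(** * Maximal inequality for exponential moments *)

Section MaximalInequality.
Context {d : measure_display} {T : measurableType d} {R : realType}.
Variable P : probability T R.
Variable X : nat -> {RV P >-> R}.
Hypothesis indepX : mutually_independent X.
Variables (h : R -> R) (t q : R).
Hypothesis mh : measurable_fun [set: R] h.
Hypothesis q0 : 0 <= q.
Hypothesis hq : forall j, (\int[P]_w (expR (h (X j w)))%:E <= (expR q)%:E)%E.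

(** The walk with increments [h (X i)] is frozen once it has reached [t]. In
    this way its running maximum up to time [N] is read off from the single
    variable at time [N]. *)
Let step (z x : R) := if t <= z then z else z + h x.

Fixpoint stopped_walk (j : nat) (w : T) : R :=
  if j is k.+1 then step (stopped_walk k w) (X k.+1 w) else 0.

Let measurable_step d' (U : measurableType d') (f g : U -> R) :
  measurable_fun [set: U] f -> measurable_fun [set: U] g ->
  measurable_fun [set: U] (fun w => step (f w) (g w)).
Proof.
move=> mf mg; rewrite /step; apply: measurable_fun_ifT => //.
  by apply: measurable_fun_ler => //; exact: measurable_cst.
by apply: measurable_funD => //; exact: measurableT_comp.
Qed.

Lemma stopped_walk_adapted j A : measurable A ->
  <<s past X j >> (stopped_walk j @^-1` A).
Proof.
elim: j A => [|j IH] A mA.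
  suff : @measurable_fun _ _ (g_sigma_algebraType (past X 0)) R setT (stopped_walk 0).
    by move=> /(_ measurableT A mA); rewrite setTI.
  exact: measurable_cst.
suff : @measurable_fun _ _ (g_sigma_algebraType (past X j.+1)) R setT (stopped_walk j.+1).
  by move=> /(_ measurableT A mA); rewrite setTI.
apply: measurable_step.
  move=> _ B mB; rewrite setTI; move: (IH B mB).
  apply: sub_smallest2r; first exact: smallest_sigma_algebra.
  exact: sub_past.
move=> _ B mB; rewrite setTI; apply: sub_gen_smallest.
exact: past_preimage.
Qed.

Lemma measurable_stopped_walk j : measurable_fun [set: T] (stopped_walk j).
Proof.
move=> _ A mA; rewrite setTI.
exact: (past_measurable (@stopped_walk_adapted j A mA)).
Qed.

HB.instance Definition _ j :=
  isMeasurableFun.Build _ _ _ _ (stopped_walk j) (measurable_stopped_walk j).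

(** A step multiplies the exponential moment by at most [exp q]: by independence
    of the past when the walk moves, and because [0 <= q] when it is frozen. *)
Lemma expectation_stopped_walk j :
  (\int[P]_w (expR (stopped_walk j w))%:E <= (expR (q * j%:R))%:E)%E.
Proof.
elim: j => [|j IH].
  rewrite /= integral_cst// mulr0 expR0 mul1e.
  exact: probability_le1.
have mE : measurable_fun [set: (R * R)%type] (fun zx : R * R => (expR (step zx.1 zx.2))%:E).
  by apply/measurable_EFinP; apply: measurableT_comp => //; exact: measurable_step.
have E0 (zx : R * R) : (0 <= (expR (step zx.1 zx.2))%:E)%E by rewrite lee_fin expR_ge0.
pose Z : {RV P >-> R} := stopped_walk j : {mfun T >-> R}.
rewrite /= (past_fubini indepX (Z := Z) (@stopped_walk_adapted j) mE E0).
have mexp : measurable_fun [set: R] (fun z : R => (expR z)%:E).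
  by apply/measurable_EFinP; exact: measurable_expR.
have meh : measurable_fun [set: R] (fun x : R => (expR (h x))%:E).
  by apply/measurable_EFinP; apply: measurableT_comp.
apply: (@le_trans _ _ (\int[distribution P Z]_z ((expR q)%:E * (expR z)%:E))%E).
  apply: ge0_le_integral => //.
  - by move=> z _; apply: integral_ge0.
  - exact: (measurable_fun_fubini_tonelli_F (m2 := distribution P (X j.+1)) _ mE E0).
  - by apply/measurable_EFinP; apply: measurable_funM => //; exact: measurable_expR.
  move=> z _ /=; rewrite /step; case: (leP t z) => _.
    rewrite integral_cst// [X in (_ * X)%E](_ : _ = 1%E); last exact: probability_setT.
    rewrite mule1 lee_fin.
    by rewrite ler_peMl ?expR_ge0// -[leLHS]expR0 ler_expR.
  under eq_integral do rewrite expRD EFinM.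
  rewrite ge0_integralZl//.
  rewrite [leRHS]muleC lee_wpmul2l ?lee_fin ?expR_ge0//.
  rewrite ge0_integral_distribution//; exact: hq.
rewrite ge0_integralZl//.
rewrite ge0_integral_distribution//.
rewrite -natr1 mulrDr mulr1 addrC expRD EFinM lee_wpmul2l ?lee_fin ?expR_ge0//.
Qed.

Let walk j w := \sum_(1 <= i < j.+1) h (X i w).

Let walk_stopped j w : stopped_walk j w < t ->
  stopped_walk j w = walk j w /\ forall i, (0 < i <= j)%N -> walk i w < t.
Proof.
elim: j => [|j IH] /=.
  by move=> _; rewrite /walk big_nil; split => // i; case: i.
rewrite /step; case: (leP t (stopped_walk j w)) => [tz /(le_lt_trans tz)|zt].
  by rewrite ltxx.
have [-> ih] := IH zt.
have -> : walk j w + h (X j.+1 w) = walk j.+1 w by rewrite /walk [RHS]big_nat_recr.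
move=> wt; split => // i /andP[i0]; rewrite leq_eqVlt => /predU1P[->//|ij].
by apply: ih; rewrite i0.
Qed.

(** Chernoff's bound for the stopped walk. The event itself is only included in
    a measurable set of small probability, which is all that Borel-Cantelli
    needs. *)
Lemma maximal_inequality N :
  exists2 A : set T, measurable A &
    [set w | exists2 j, (0 < j <= N)%N & t <= walk j w] `<=` A /\
    (P A <= (expR (q * N%:R - t))%:E)%E.
Proof.
pose Z : {RV P >-> R} := stopped_walk N : {mfun T >-> R}.
exists [set w | t <= Z w].
  rewrite -[X in measurable X]setTI.
  have := @measurable_stopped_walk N measurableT `[t, +oo[%classic (measurable_itv _).
  congr measurable; congr (_ `&` _).
  by apply/seteqP; split => w /=; rewrite in_itv/= andbT.
split.
  move=> w [j jN tw] /=; rewrite leNgt; apply/negP => zt.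
  by have [_ /(_ j jN)] := walk_stopped zt; rewrite ltNge tw.
apply: (le_trans (chernoff Z t ltr01)).
rewrite mul1r expRD EFinM lee_wpmul2r ?lee_fin ?expR_ge0//.
apply: le_trans (expectation_stopped_walk N).
rewrite /mmt_gen_fun unlock le_eqVlt; apply/orP; left; apply/eqP.
by apply: eq_integral => w _ /=; rewrite mulr1.
Qed.

End MaximalInequality.

(** * Borel-Cantelli lemmas *)

Section BorelCantelli.
Context {d : measure_display} {T : measurableType d} {R : realType}.
Variable P : probability T R.

Lemma nneseries_bounded (u : nat -> \bar R) (M : \bar R) :
  (forall n, 0 <= u n)%E -> (forall n, \sum_(0 <= i < n) u i <= M)%E ->
  (\sum_(i <oo) u i <= M)%E.
Proof.
move=> u0 uM; apply: lime_le; first exact: is_cvg_nneseries.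
exact: nearW.
Qed.

Lemma borel_cantelli1 (F : nat -> set T) : (forall n, measurable (F n)) ->
  (\sum_(n <oo) P (F n) < +oo)%E ->
  {ae P, forall w, \forall k \near \oo, ~ F k w}.
Proof.
move=> mF sF; exists (lim_sup_set F); split.
- by apply: bigcapT_measurable => n; exact: bigcup_measurable.
- exact: lim_sup_set_cvg0.
move=> w /= nw n _; apply: contrapT => h; apply: nw.
exists n => // k nk Fk; apply: h; exists k => //.
Qed.

Variable X : nat -> {RV P >-> R}.
Hypothesis indepX : mutually_independent X.

(** [P (no event between K and m)] is a product of factors
    [1 - p k <= exp (- p k)]. *)
Lemma borel_cantelli2 (A : nat -> set R) : (forall n, measurable (A n)) ->
  (forall M : R, exists m, M <= \sum_(0 <= k < m) fine (P (X k @^-1` A k))) ->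
  {ae P, forall w, forall K, exists2 k, (K <= k)%N & A k (X k w)}.
Proof.
move=> mA hA; pose p k := fine (P (X k @^-1` A k)).
have mX k B : measurable B -> measurable (X k @^-1` B).
  by move=> mB; rewrite -[_ @^-1` _]setTI; exact: measurable_funP.
pose N K := \bigcap_(k in [set k | (K <= k)%N]) (X k @^-1` (~` A k)).
have mN K : measurable (N K).
  by apply: bigcap_measurableType => k _; apply/mX/measurableC.
have pE k : P (X k @^-1` A k) = (p k)%:E.
  by rewrite /p fineK//; apply: fin_num_measure; exact: mX.
have pCE k : P (X k @^-1` (~` A k)) = (1 - p k)%:E.
  rewrite preimage_setC probability_setC ?pE//; exact: mX.
have Nle K m : (P (N K) <= (expR (- \sum_(K <= k < m) p k))%:E)%E.
  apply: (@le_trans _ _ (P (\bigcap_(k in [set` index_iota K m]) (X k @^-1` (~` A k))))).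
    apply: le_measure; rewrite ?inE//.
      by apply: bigcap_measurableType => k _; apply/mX/measurableC.
    by move=> w Nw k; rewrite /= mem_index_iota => /andP[Kk _]; exact: Nw.
  rewrite (indepX (A := fun k => ~` A k)) ?iota_uniq//; last first.
    by move=> k; exact: measurableC.
  under eq_bigr do rewrite pCE.
  rewrite prodEFin lee_fin -sumrN expR_sum; apply: ler_prod => k _.
  rewrite expR_ge1Dx andbT -lee_fin -pCE; exact: measure_ge0.
have N0 K : P (N K) = 0%E.
  apply/eqP; rewrite eq_le measure_ge0 andbT; apply/lee_addgt0Pr => e e0.
  rewrite add0e; have [m hm] := hA (- ln e + \sum_(0 <= k < K) p k).
  have Km : \sum_(0 <= k < m) p k <= \sum_(0 <= k < maxn K m) p k.
    rewrite [leRHS](@big_cat_nat _ _ _ m)//= ?leq_maxr// lerDl sumr_ge0// => k _.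
    by rewrite /p fine_ge0.
  apply: (le_trans (Nle K (maxn K m))); rewrite lee_fin -[leRHS]lnK ?posrE//.
  rewrite ler_expR lerNl -(lerD2r (\sum_(0 <= k < K) p k)).
  apply: le_trans hm (le_trans Km _).
  by rewrite (@big_cat_nat _ _ _ K)//= ?leq_maxl// addrC.
apply: ae_foralln => K; exists (N K); split; [exact: mN|exact: N0|].
move=> w /= nw k /= Kk Ak.
by apply: nw; exists k.
Qed.

End BorelCantelli.

(** * Moments and tail sums *)

Lemma measurable_gt {d : measure_display} {T : measurableType d} {R : realType}
    (f : T -> R) (r : R) :
  measurable_fun [set: T] f -> measurable [set w | r < f w].
Proof.
move=> mf; rewrite -[X in measurable X]setTI.
have := mf measurableT `]r, +oo[%classic (measurable_itv _).
congr measurable; congr (_ `&` _).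
by apply/seteqP; split => w /=; rewrite in_itv/= andbT.
Qed.

Section Moments.
Context {d : measure_display} {T : measurableType d} {R : realType}.
Variable P : probability T R.

(** Pointwise, the powers of [2] below [Y w] add up to less than [2 Y w]. *)
Lemma sum_dyadic_tail_le (Y : T -> R) n : measurable_fun [set: T] Y ->
  (forall w, 0 <= Y w) ->
  (\sum_(0 <= k < n) ((2 ^+ k)%:E * P [set w | (2 ^+ k < Y w)%R]) <=
   2%:E * \int[P]_w (Y w)%:E)%E.
Proof.
move=> mY Y0.
have -> : (\sum_(0 <= k < n) ((2 ^+ k)%:E * P [set w | (2 ^+ k < Y w)%R]) =
   \int[P]_w (\sum_(0 <= k < n) (2 ^+ k * \1_[set w | (2 ^+ k < Y w)%R] w)%:E))%E.
  rewrite ge0_integral_sum//; last first.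
    move=> k; apply/measurable_EFinP; apply: measurable_funM => //.
    by apply: measurable_indic; exact: measurable_gt.
  apply: eq_bigr => k _; under eq_integral do rewrite EFinM.
  rewrite ge0_integralZl ?lee_fin ?exprn_ge0//; last first.
    by apply/measurable_EFinP/measurable_indic; exact: measurable_gt.
  by rewrite integral_indic ?setIT//; exact: measurable_gt.
rewrite -ge0_integralZl//; [|exact/measurable_EFinP|by move=> w _; rewrite lee_fin].
apply: ge0_le_integral => //.
- by move=> w _; apply: sume_ge0 => k _; rewrite lee_fin mulr_ge0// exprn_ge0.
- apply: emeasurable_sum => k; apply/measurable_EFinP; apply: measurable_funM => //.
  by apply: measurable_indic; exact: measurable_gt.
- by apply: measurable_funeM; exact/measurable_EFinP.
move=> w _; rewrite sumEFin -EFinM lee_fin.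
elim: n => [|n IH]; first by rewrite big_nil mulr_ge0.
rewrite big_nat_recr//= indicE; case: (boolP (w \in _)) => [|_]; last first.
  by rewrite mulr0 addr0.
rewrite inE /= => hw; rewrite mulr1.
have : \sum_(0 <= i < n) 2 ^+ i * \1_[set w | 2 ^+ i < Y w] w <= 2 ^+ n - 1 :> R.
  elim: {IH hw} n => [|n IH]; first by rewrite big_nil expr0 subrr.
  rewrite big_nat_recr//= exprS mulr2n mulrDl mul1r addrAC lerD// indicE.
  by rewrite ler_piMr// ?exprn_ge0// lern1 leq_b1.
lra.
Qed.

(** Pointwise, the number of integers [k < n] below [Y w] is at least the
    minimum of [Y w] and [n]. *)
Lemma integral_le_sum_tail (Y : T -> R) : measurable_fun [set: T] Y ->
  (forall w, 0 <= Y w) ->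
  (\int[P]_w (Y w)%:E <= \sum_(k <oo) P [set w | (k%:R < Y w)%R])%E.
Proof.
move=> mY Y0.
have -> : (\sum_(k <oo) P [set w | (k%:R < Y w)%R] =
    \int[P]_w (\sum_(k <oo) (\1_[set w | (k%:R < Y w)%R] w)%:E))%E.
  rewrite integral_nneseries//; last first.
    by move=> k; apply/measurable_EFinP/measurable_indic; exact: measurable_gt.
  apply: eq_eseriesr => k _; rewrite integral_indic ?setIT//; exact: measurable_gt.
apply: ge0_le_integral => //.
- by move=> w _; rewrite lee_fin.
- exact/measurable_EFinP.
- by apply: ge0_emeasurable_sum => // k _; apply/measurable_EFinP/measurable_indic; exact: measurable_gt.
move=> w _; pose n := (Num.truncn (Y w)).+1.
have Yn : Y w <= n%:R by rewrite ltW// truncnS_gt.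
apply: le_trans (nneseries_lim_ge n _) => //.
rewrite sumEFin lee_fin -[leLHS](min_l Yn).
elim: n {Yn} => [|n IH]; first by rewrite big_nil ge_min lexx orbT.
rewrite big_nat_recr//= indicE; case: (boolP (w \in _)) => [|].
  rewrite inE /= => hw; rewrite (le_trans _ (lerD IH (lexx _)))//.
  by rewrite (min_r (ltW hw)) ge_min natr1 lexx orbT.
rewrite notin_setE /= => /negP; rewrite -leNgt => hw; rewrite addr0 (le_trans _ IH)//.
by rewrite (min_l hw) ge_min lexx.
Qed.

End Moments.

(** * Almost sure upper bound *)

Section UpperBound.
Context {R : realType}.

Lemma measurable_Llog : measurable_fun [set: R] (@Llog R).
Proof.
apply: measurableT_comp; first exact: measurable_ln.
by apply: measurable_maxr => //; exact: measurable_cst.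
Qed.

Lemma measurable_phi (a b : R) : measurable_fun [set: R] (fun x => phi a b `|x|).
Proof.
rewrite (_ : (fun _ => _) =
    fun x => `|x| `^ a * (Llog `|x|) `^ (- (b * a))); last first.
  by apply/funext => x; rewrite powRN.
have mn : measurable_fun [set: R] (@Num.norm R R) by exact: normr_measurable.
apply: measurable_funM; first exact: (measurableT_comp (measurable_powR a) mn).
have mL := measurableT_comp measurable_Llog mn.
exact: (measurableT_comp (measurable_powR (- (b * a))) mL).
Qed.

Lemma measurable_truncation (a b K z : R) :
  measurable_fun [set: R] (truncation a b K z).
Proof.
apply: measurable_fun_ifT => //; last exact: measurable_funM.
by apply: measurable_fun_ler => //; exact: measurable_phi.
Qed.

Context {d : measure_display} {T : measurableType d}.
Variable P : probability T R.
Variable X : nat -> {RV P >-> R}.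

Lemma identically_distributed_integral (f : R -> \bar R) i j :
  identically_distributed X ->
  measurable_fun [set: R] f -> (forall x, 0 <= f x)%E ->
  (\int[P]_w f (X i w) = \int[P]_w f (X j w))%E.
Proof.
move=> idX mf f0; rewrite -(ge0_integral_distribution (X i) mf f0).
rewrite -(ge0_integral_distribution (X j) mf f0).
by apply: eq_measure_integral => A mA _; exact: idX.
Qed.

Hypothesis iidX : iid X.
Variables a b c : R.
Hypotheses (a0 : 0 < a) (a2 : a <= 2) (b0 : 0 <= b).
Let Y w := phi a b `|X 0 w|.
Hypothesis Yfin : (\int[P]_w (Y w)%:E < +oo)%E.
Hypothesis linI : P.-integrable [set: T] (fun w => (linear_part a (X 0 w))%:E).
Hypothesis linE : (\int[P]_w (linear_part a (X 0 w))%:E = c%:E)%E.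

Let mphiX i : measurable_fun [set: T] (fun w => phi a b `|X i w|).
Proof. exact: (measurableT_comp (measurable_phi a b)). Qed.

Let YI : P.-integrable [set: T] (fun w => (Y w)%:E).
Proof.
apply/integrableP; split; first exact/measurable_EFinP/mphiX.
by under eq_integral do rewrite gee0_abs ?lee_fin ?phi_ge0//.
Qed.

Let m := fine (\int[P]_w (Y w)%:E)%E.

Let mE : (\int[P]_w (Y w)%:E = m%:E)%E.
Proof. by rewrite fineK//; exact: integrable_fin_num. Qed.

Let m0 : 0 <= m.
Proof. by rewrite fine_ge0// integral_ge0// => w _; rewrite lee_fin phi_ge0. Qed.

(** Integrating the pointwise bound gives
    [1 + s c / M + C m / z <= exp (s c / M + C m / z)] with [M] the scale at
    [z], and centring by [c / M] removes the first term of the exponent. *)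
Lemma mgf_truncation_le K C z s j :
  0 < K -> 0 <= C -> 0 < z -> `|s| = 1 ->
  (forall x, expR (s * truncation a b K z x) <=
    1 + s * (linear_part a x / scale a b K z) + C * (phi a b `|x| / z)) ->
  (\int[P]_w (expR (s * (truncation a b K z (X j w) - c / scale a b K z)))%:E <=
    (expR (C * m / z))%:E)%E.
Proof.
move=> K0 C0 z0 s1 H; have M0 := scale_gt0 a b K0 z0.
set M := scale a b K z in H M0 *.
have mh : measurable_fun [set: R]
    (fun x => (expR (s * (truncation a b K z x - c / M)))%:E).
  apply/measurable_EFinP; apply: measurableT_comp; first exact: measurable_expR.
  apply: measurable_funM => //; apply: measurable_funB => //.
  exact: measurable_truncation.
rewrite (identically_distributed_integral j 0 iidX.2 mh); last first.
  by move=> x; rewrite lee_fin expR_ge0.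
pose k0 := expR (- (s * (c / M))).
pose G w := (k0%:E * (1%:E + ((s / M)%:E * (linear_part a (X 0 w))%:E + (C / z)%:E * (Y w)%:E)))%E.
have GI1 : P.-integrable [set: T] (fun w => (s / M)%:E * (linear_part a (X 0 w))%:E)%E.
  exact: integrableZl.
have GI2 : P.-integrable [set: T] (fun w => (C / z)%:E * (Y w)%:E)%E.
  exact: integrableZl.
have GI3 : P.-integrable [set: T] (fun w => (s / M)%:E * (linear_part a (X 0 w))%:E +
    (C / z)%:E * (Y w)%:E)%E by exact: integrableD.
have GI0 : P.-integrable [set: T] (fun _ => 1%:E).
  exact: finite_measure_integrable_cst.
have GI4 : P.-integrable [set: T] (fun w => 1%:E + ((s / M)%:E * (linear_part a (X 0 w))%:E +
    (C / z)%:E * (Y w)%:E))%E by exact: integrableD.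
have GI : P.-integrable [set: T] G by exact: integrableZl.
have GE : (\int[P]_w G w = (k0 * (1 + (s / M * c + C / z * m)))%:E)%E.
  have I1 : (\int[P]_w 1%:E = 1%:E)%E.
    by rewrite integral_cst// mul1e; exact: probability_setT.
  by rewrite /G integralZl// integralD// integralD// !integralZl// linE mE I1.
have hG w : ((expR (s * (truncation a b K z (X 0 w) - c / M)))%:E <= G w)%E.
  have -> : G w = (k0 * (1 + (s / M * linear_part a (X 0 w) + C / z * Y w)))%:E by [].
  rewrite lee_fin mulrBr expRD mulrC ler_wpM2l ?expR_ge0//.
  apply: (le_trans (H _)); rewrite le_eqVlt; apply/orP; left; apply/eqP.
  by rewrite /Y; ring.
apply: (@le_trans _ _ (\int[P]_w G w)%E).
  apply: ge0_le_integral => //.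
  - exact: (measurableT_comp mh).
  - by have /integrableP[] := GI.
rewrite GE lee_fin /k0.
apply: (@le_trans _ _ (expR (- (s * (c / M))) * expR (s / M * c + C / z * m))).
  by rewrite ler_wpM2l ?expR_ge0// expR_ge1Dx.
rewrite -expRD ler_expR le_eqVlt; apply/orP; left; apply/eqP.
by field; rewrite !gt_eqF.
Qed.

Let S n w : R := partial_sum X n w.

(** Telescoping, from [1 / k^2 <= 2 / (k (k + 1))]. *)
Let sum_inv_sq_le n :
  \sum_(0 <= k < n) ((k.+1%:R : R) ^- 2) <= 2 - 2 / n.+1%:R.
Proof.
elim: n => [|n IH]; first by rewrite big_nil divr1 subrr.
rewrite big_nat_recr//= (le_trans (lerD IH (lexx _)))//.
have n1 : 0 < (n.+1%:R : R) by rewrite ltr0n.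
have n2 : 0 < (n.+2%:R : R) by rewrite ltr0n.
rewrite -subr_ge0.
have -> : 2 - 2 / n.+2%:R - (2 - 2 / n.+1%:R + n.+1%:R ^- 2) =
    (2 * n.+1%:R * (n.+2%:R - n.+1%:R) - n.+2%:R) / (n.+1%:R ^+ 2 * n.+2%:R) :> R.
  by field; rewrite !gt_eqF.
rewrite divr_ge0 ?mulr_ge0 ?exprn_ge0 ?(ltW n1) ?(ltW n2)//.
rewrite -(natr1 n.+1) [_ + 1 - _]addrAC subrr add0r mulr1 -natr1.
by have := ler0n R n; lra.
Qed.

(** At [z = 2^k] the exponential moment of a walk of length [2^(k+1)] is at most
    [exp (2 C m)], with [m] the moment of [phi]. The threshold [2 ln k.+1] then
    has probability [O(k.+1^-2)], which is summable. *)
Lemma truncated_sum_bound K C s :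
  0 < K -> 0 <= C -> `|s| = 1 ->
  (forall x z, 0 < z -> expR (s * truncation a b K z x) <=
    1 + s * (linear_part a x / scale a b K z) + C * (phi a b `|x| / z)) ->
  {ae P, forall w, \forall k \near \oo, forall j, (0 < j <= 2 ^ k.+1)%N ->
    \sum_(1 <= i < j.+1) s * (truncation a b K (2 ^+ k) (X i w) - c / scale a b K (2 ^+ k))
      < 2 * ln k.+1%:R}.
Proof.
move=> K0 C0 s1 H.
pose h k (x : R) := s * (truncation a b K (2 ^+ k) x - c / scale a b K (2 ^+ k)).
have z0 k : 0 < (2 : R) ^+ k by rewrite exprn_gt0.
have mh k : measurable_fun [set: R] (h k).
  apply: measurable_funM => //; apply: measurable_funB => //.
  exact: measurable_truncation.
have q0 k : 0 <= C * m / 2 ^+ k by rewrite divr_ge0 ?mulr_ge0 ?(ltW (z0 k)).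
have hq k j : (\int[P]_w (expR (h k (X j w)))%:E <= (expR (C * m / 2 ^+ k))%:E)%E.
  by apply: mgf_truncation_le => // x; exact: H.
have /choice[A hA] k : exists A : set T, [/\ measurable A,
    [set w | exists2 j, (0 < j <= 2 ^ k.+1)%N &
       2 * ln k.+1%:R <= \sum_(1 <= i < j.+1) h k (X i w)] `<=` A &
    (P A <= (expR (2 * (C * m)) * k.+1%:R ^- 2)%:E)%E].
  have [A mA [sA PA]] := maximal_inequality iidX.1 (2 * ln k.+1%:R) (mh k) (q0 k) (hq k) (2 ^ k.+1).
  exists A; split => //; apply: (le_trans PA); rewrite lee_fin expRD expRN.
  have -> : C * m / 2 ^+ k * (2 ^ k.+1)%:R = 2 * (C * m).
    by rewrite natrX exprS; field; rewrite gt_eqF.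
  by rewrite expRM_natl lnK// posrE ltr0n.
have := @borel_cantelli1 _ _ _ P A (fun k => let: And3 mA _ _ := hA k in mA).
case.
  apply: (@le_lt_trans _ _ (expR (2 * (C * m)) * 2)%:E); last exact: ltry.
  apply: nneseries_bounded => // n.
  apply: (@le_trans _ _ (\sum_(0 <= k < n) (expR (2 * (C * m)) * k.+1%:R ^- 2)%:E)%E).
    by apply: lee_sum => k _; case: (hA k).
  rewrite sumEFin lee_fin -mulr_sumr ler_wpM2l ?expR_ge0//.
  apply: (le_trans (sum_inv_sq_le n)); rewrite lerBlDr lerDl divr_ge0//.
move=> N [mN N0 sN]; exists N; split => //; apply: subset_trans sN.
apply: subsetC => w; apply: filterS => k nA j jk.
rewrite ltNge; apply/negP => tj; apply: nA.
by have [_ sA _] := hA k; apply: sA; exists j.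
Qed.

(** The [k]-th event has probability at most [2^(k+1) P(phi(|X|) > 2^k)], and
    these are summable because [phi(|X|)] has a finite expectation. *)
Lemma eventually_no_large_summand :
  {ae P, forall w, \forall k \near \oo, forall i, (0 < i <= 2 ^ k.+1)%N ->
    phi a b `|X i w| <= 2 ^+ k}.
Proof.
have mgt i (r : R) : measurable [set w | r < phi a b `|X i w|].
  exact: measurable_gt.
have mgtR (r : R) : measurable [set x : R | r < phi a b `|x|].
  by apply: measurable_gt; exact: measurable_phi.
pose F k := \big[setU/set0]_(i < 2 ^ k.+1) [set w | 2 ^+ k < phi a b `|X i.+1 w|].
have mF k : measurable (F k) by apply: bigsetU_measurable => i _; exact: mgt.
have PF k : (P (F k) <= 2%:E * ((2 ^+ k)%:E * P [set w | (2 ^+ k < Y w)%R]))%E.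
  pose B i := [set w | 2 ^+ k < phi a b `|X i.+1 w|].
  apply: (le_trans (@Boole_inequality _ _ _ P B (2 ^ k.+1) (fun i _ => mgt _ _))).
  have pE : P [set w | (2 ^+ k < Y w)%R] = (fine (P [set w | (2 ^+ k < Y w)%R]))%:E.
    by rewrite fineK//; apply: fin_num_measure; exact: mgt.
  rewrite pE (eq_bigr (fun=> (fine (P [set w | (2 ^+ k < Y w)%R]))%:E)); last first.
    by move=> i _; rewrite -pE; exact: (iidX.2 i.+1 0 _ (mgtR (2 ^+ k))).
  set p := fine _; rewrite sumEFin sumr_const card_ord -!EFinM lee_fin.
  by rewrite mulrA -exprS -natrX mulr_natl.
have := @borel_cantelli1 _ _ _ P F mF.
case.
  apply: (@le_lt_trans _ _ (2%:E * (2%:E * \int[P]_w (Y w)%:E))%E); last first.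
    by rewrite mE -!EFinM ltry.
  apply: nneseries_bounded => // n.
  apply: (@le_trans _ _ (\sum_(0 <= k < n) (2%:E * ((2 ^+ k)%:E * P [set w | (2 ^+ k < Y w)%R])))%E).
    by apply: lee_sum => k _; exact: PF.
  rewrite -ge0_sume_distrr; last first.
    by move=> k _; rewrite mule_ge0// lee_fin exprn_ge0.
  rewrite lee_wpmul2l// ?lee_fin//; apply: sum_dyadic_tail_le; first exact: mphiX.
  by move=> w; exact: phi_ge0.
move=> N [mN N0 sN]; exists N; split => //; apply: subset_trans sN.
apply: subsetC => w; apply: filterS => k nF [//|i] /= ik.
rewrite leNgt; apply/negP => hi; apply: nF.
by rewrite /F -(bigcup_mkord _ (fun i => [set w | 2 ^+ k < phi a b `|X i.+1 w|])); exists i.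
Qed.

(** On the [k]-th block the summands eventually coincide with their truncations,
    so [S n - n c] is the scale times the walk of the truncated summands; the
    signs [s = 1] and [s = -1] bound that walk from above and below. *)
Lemma partial_sum_upper_bound e : 0 < e ->
  {ae P, forall w, \forall n \near \oo,
    `|S n w - n%:R * c| <= n%:R `^ a^-1 * ln n%:R `^ (b + e)}.
Proof.
move=> e0; have [K K0 [C C0 H]] := expR_truncation_le a0 a2 b0.
have n1 : `|1 : R| = 1 by rewrite normr1.
have nN1 : `|- 1 : R| = 1 by rewrite normrN1.
have A1 := truncated_sum_bound K0 C0 n1 (fun x z => H 1 x z n1).
have A2 := truncated_sum_bound K0 C0 nN1 (fun x z => H (- 1) x z nN1).
have A3 := eventually_no_large_summand.
apply: filterS3 A1 A2 A3 => w h1 h2 h3.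
apply: (near_block_bound (S := fun n => S n w - n%:R * c) a0 b0 K0 e0).
apply: filterS3 h1 h2 h3 => k g1 g2 g3 j jk.
set M := scale a b K (2 ^+ k) in g1 g2 *.
have M0 : 0 < M by rewrite scale_gt0// exprn_gt0.
move: g1 g2 => /(_ j jk) g1 /(_ j jk) g2.
have SE : S j w - j%:R * c =
    M * \sum_(1 <= i < j.+1) (truncation a b K (2 ^+ k) (X i w) - c / M).
  rewrite mulr_sumr /S /partial_sum.
  rewrite (_ : j%:R * c = \sum_(1 <= i < j.+1) c); last first.
    by rewrite sumr_const_nat subSS subn0 mulr_natl.
  rewrite -sumrB !big_nat; apply: eq_bigr => i /andP[i1 ij].
  rewrite /truncation g3; last first.
    by rewrite i1; case/andP: jk => _; apply: leq_trans.
  by rewrite -/M; field; rewrite gt_eqF.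
rewrite SE normrM (gtr0_norm M0) ler_wpM2l ?(ltW M0)// ler_norml.
move: g1 g2; rewrite -!mulr_sumr mul1r mulN1r => g1 g2.
by rewrite (ltW g1) andbT lerNl ltW.
Qed.

End UpperBound.

(** * Almost sure lower bound *)

Section LowerBound.
Context {d : measure_display} {T : measurableType d} {R : realType}.
Variable P : probability T R.
Variable X : nat -> {RV P >-> R}.
Hypothesis iidX : iid X.

(** An infinite expectation of [phi(|X|)] makes [P(phi(|X_n|) > n)] sum to
    infinity, and the second Borel-Cantelli lemma yields infinitely many large
    summands. *)
Lemma limn_esup_lower_bound a b : 0 < a -> 0 < b ->
  (\int[P]_w (phi a b `|X 0 w|)%:E = +oo)%E ->
  {ae P, forall w,
    ((expR b)%:E <= limn_esup (fun n => (rate a (fun k => partial_sum X k w) n)%:E))%E}.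
Proof.
move=> a0 b0 Yoo.
pose A n : set R := [set x | n%:R < phi a b `|x|].
have mA n : measurable (A n) by apply: measurable_gt; exact: measurable_phi.
have mphi : measurable_fun [set: T] (fun w => phi a b `|X 0 w|).
  exact: (measurableT_comp (measurable_phi a b)).
have io : {ae P, forall w, forall K, exists2 k, (K <= k)%N & A k (X k w)}.
  apply: borel_cantelli2 => //; first exact: iidX.1.
  move=> M; apply: contrapT => hM.
  have : (\sum_(k <oo) P [set w | (k%:R < phi a b `|X 0 w|)%R] <= M%:E)%E.
    apply: nneseries_bounded => // n.
    rewrite (eq_bigr (fun k => (fine (P (X k @^-1` A k)))%:E)).
      rewrite sumEFin lee_fin leNgt; apply/negP => h; apply: hM.
      by exists n; exact: ltW.
    move=> k _; rewrite fineK; first exact: (iidX.2 0 k _ (mA k)).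
    apply: fin_num_measure; rewrite -[X in measurable X]setTI.
    exact: measurable_funP.
  rewrite leNgt => /negP; apply; apply: lt_le_trans (ltry M) _; rewrite -Yoo.
  by apply: integral_le_sum_tail => // w; exact: phi_ge0.
apply: filterS io => w hw; apply: (limn_esup_rate_ge (x := fun n => X n w) a0 b0) => //.
by move=> n; rewrite /partial_sum big_nat_recr.
Qed.

End LowerBound.

(** * Approximation and comparison of moments *)

Section Reduction.
Context {R : realType}.

Lemma exists_invS_le (e : R) : 0 < e -> exists n, (n.+1%:R : R)^-1 <= e.
Proof.
move=> e0; have /(@filter_ex _ \oo)[n hn] := nbhs_infty_ger e^-1.
exists n; rewrite -[leRHS]invrK lef_pV2 ?posrE ?ltr0n ?invr_gt0//.
by rewrite (le_trans hn)// ler_nat.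
Qed.

Lemma le_expR_approx (L : \bar R) r :
  (forall n, L <= (expR (r + n.+1%:R^-1))%:E)%E -> (L <= (expR r)%:E)%E.
Proof.
case: L => [l| |] h; [|by have := h 0; rewrite leye_eq|exact: leNye].
rewrite lee_fin; have [l0|l0] := leP l 0; first exact: le_trans l0 (expR_ge0 r).
rewrite -[leLHS]lnK ?posrE// ler_expR; apply/ler_addgt0Pr => e e0.
have [n ne] := exists_invS_le e0; have := h n.
rewrite lee_fin -[leLHS]lnK ?posrE// ler_expR => /le_trans; apply.
by rewrite lerD2l.
Qed.

(** The approximating exponents [r (1 - 1 / (n + 2))] are positive, as the lower
    bound for the limit superior requires. *)
Lemma ge_expR_approx (L : \bar R) r : 0 < r ->
  (forall n, (expR (r * (1 - n.+2%:R^-1)))%:E <= L)%E -> ((expR r)%:E <= L)%E.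
Proof.
move=> r0; case: L => [l| |] h; [|exact: leey|by have := h 0].
have l0 : 0 < l by have := h 0; rewrite lee_fin; apply: lt_le_trans; exact: expR_gt0.
rewrite lee_fin -[leRHS]lnK ?posrE// ler_expR; apply/ler_addgt0Pr => e e0.
have er0 : 0 < e / r by rewrite divr_gt0.
have [n ne] := exists_invS_le er0; have := h n.
rewrite lee_fin -[leRHS]lnK ?posrE// ler_expR mulrBr mulr1 lerBlDr.
move=> /le_trans; apply; rewrite lerD2l mulrC -ler_pdivlMr//.
apply: le_trans ne. by rewrite lef_pV2 ?posrE ?ltr0n// ler_nat leqnSn.
Qed.

(** The two parts of [scale_exists] at [z = 1]. *)
Lemma le_affine_phi (a b : R) : 1 < a -> 0 <= b ->
  exists A B, forall x, 0 <= x -> x <= A + B * phi a b x.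
Proof.
move=> a1 b0; have a0 : 0 < a by lra.
have [K K0 [h1 /(_ a1)[C C0 h2]]] := scale_exists a0 b0.
pose M := scale a b K 1; have M0 : 0 < M by exact: scale_gt0.
exists M, (M * C) => x x0; have p0 := phi_ge0 a b x.
have Cp : 0 <= M * C * phi a b x by apply: mulr_ge0 => //; apply: mulr_ge0; exact: ltW.
have [p1|p1] := leP (phi a b x) 1.
  have := h1 x 1 x0 ltr01 p1; rewrite divr1 -/M => hx.
  have : x / M <= 1.
    by apply: powR_le1_le1 a0 _ (le_trans hx p1); rewrite divr_ge0// ltW.
  by rewrite ler_pdivrMr// mul1r; lra.
have := h2 x 1 x0 ltr01 (ltW p1); rewrite divr1 -/M ler_pdivrMr//.
have -> : C * phi a b x * M = M * C * phi a b x by ring.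
lra.
Qed.

Context {d : measure_display} {T : measurableType d}.
Variable P : probability T R.
Variable X : nat -> {RV P >-> R}.

Lemma le_moment_fin a b b' : 0 < a -> b <= b' ->
  (\int[P]_w (phi a b `|X 0 w|)%:E < +oo)%E ->
  (\int[P]_w (phi a b' `|X 0 w|)%:E < +oo)%E.
Proof.
move=> a0 bb; apply: le_lt_trans; apply: ge0_le_integral => //.
- by move=> w _; rewrite lee_fin phi_ge0.
- by apply/measurable_EFinP; exact: (measurableT_comp (measurable_phi a b')).
- by apply/measurable_EFinP; exact: (measurableT_comp (measurable_phi a b)).
by move=> w _; rewrite lee_fin le_phi.
Qed.

Lemma moment_integrable a b : 1 < a -> 0 <= b ->
  (\int[P]_w (phi a b `|X 0 w|)%:E < +oo)%E ->
  P.-integrable [set: T] (fun w => (X 0 w)%:E).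
Proof.
move=> a1 b0 Yfin; have [A [B hAB]] := le_affine_phi a1 b0.
have YI : P.-integrable [set: T] (fun w => (phi a b `|X 0 w|)%:E).
  apply/integrableP; split.
    by apply/measurable_EFinP; exact: (measurableT_comp (measurable_phi a b)).
  by under eq_integral do rewrite gee0_abs ?lee_fin ?phi_ge0//.
have GI : P.-integrable [set: T] (fun w => A%:E + B%:E * (phi a b `|X 0 w|)%:E)%E.
  apply: integrableD => //; first exact: finite_measure_integrable_cst.
  exact: integrableZl.
apply: (le_integrable _ _ _ GI) => //; first exact/measurable_EFinP.
move=> w _; rewrite abse_EFin -EFinM -EFinD abse_EFin lee_fin.
exact: le_trans (hAB _ (normr_ge0 _)) (ler_norm _).
Qed.

Lemma linear_part_mean a c :
  (1 < a -> P.-integrable [set: T] (fun w => (X 0 w)%:E) /\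
            (\int[P]_w (X 0 w)%:E = c%:E)%E) ->
  (a <= 1 -> c = 0) ->
  P.-integrable [set: T] (fun w => (linear_part a (X 0 w))%:E) /\
  (\int[P]_w (linear_part a (X 0 w))%:E = c%:E)%E.
Proof.
rewrite /linear_part; have [a1 _ /(_ isT) ->|a1 /(_ isT) h _ //] := leP a 1.
by split; [exact: integrable0|rewrite integral0].
Qed.

Lemma ae_not_false : ~ {ae P, forall w, False}.
Proof.
move=> [N [mN N0 sN]]; have := probability_setT P.
have -> : [set: T] = N by apply/seteqP; split => // w _; exact: sN.
by rewrite N0 => /eqP; rewrite eq_sym onee_eq0.
Qed.

End Reduction.

(** * The criterion *)

Section Criterion.
Context {d : measure_display} {T : measurableType d} {R : realType}.
Variable P : probability T R.
Variable X : nat -> {RV P >-> R}.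
Hypothesis iidX : iid X.
Variable a : R.
Hypotheses (a0 : 0 < a) (a2 : a <= 2).

Let L w := limn_esup (fun n => (rate a (fun k => partial_sum X k w) n)%:E).
Let moment b := (\int[P]_w (phi a b `|X 0 w|)%:E)%E.
Let centered := 1 < a ->
  P.-integrable [set: T] (fun w => (X 0 w)%:E) /\ (\int[P]_w (X 0 w)%:E = 0)%E.

Let upper b e : 0 <= b -> 0 < e -> centered -> (moment b < +oo)%E ->
  {ae P, forall w, (L w <= (expR (b + e))%:E)%E}.
Proof.
move=> b0 e0 hc mb; have [linI linE] := @linear_part_mean R _ _ P X a 0 hc (fun=> erefl).
have := partial_sum_upper_bound iidX a0 a2 b0 mb linI linE e0.
apply: filterS => w hw; apply: limn_esup_rate_le.
by apply: filterS hw => n; rewrite mulr0 subr0.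
Qed.

Let momentP b : (moment b < +oo)%E \/ moment b = +oo%E.
Proof.
by have [->|h] := eqVneq (moment b) +oo%E; [right|left; rewrite ltey].
Qed.

Lemma limn_esup_sufficient : centered ->
  (forall b, a^-1 < b -> (moment b < +oo)%E) ->
  (forall b, 0 < b -> b < a^-1 -> moment b = +oo%E) ->
  {ae P, forall w, L w = (expR a^-1)%:E}.
Proof.
move=> hc hup hlow; have ia0 : 0 < a^-1 by rewrite invr_gt0.
have U : {ae P, forall w, forall n, (L w <= (expR (a^-1 + n.+1%:R^-1))%:E)%E}.
  apply: ae_foralln => n; pose e : R := n.+1%:R^-1 / 2.
  have e0 : 0 < e by rewrite divr_gt0// invr_gt0 ltr0n.
  have -> : a^-1 + n.+1%:R^-1 = (a^-1 + e) + e by rewrite -addrA /e -splitr.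
  by apply: upper => //; [lra|apply: hup; lra].
have V : {ae P, forall w, forall n, ((expR (a^-1 * (1 - n.+2%:R^-1)))%:E <= L w)%E}.
  apply: ae_foralln => n.
  have n1 : 0 < 1 - n.+2%:R^-1 :> R by rewrite subr_gt0 invf_lt1 ?ltr0n// ltr1n.
  have b0 : 0 < a^-1 * (1 - n.+2%:R^-1) by rewrite mulr_gt0.
  apply: (limn_esup_lower_bound iidX a0 b0); apply: hlow => //.
  by rewrite gtr_pMr// ltrBlDr ltrDl invr_gt0 ltr0n.
apply: filterS2 U V => w Uw Vw; apply/eqP; rewrite eq_le.
by rewrite (le_expR_approx Uw) (ge_expR_approx ia0 Vw).
Qed.

Hypothesis HL : {ae P, forall w, L w = (expR a^-1)%:E}.

Lemma moment_fin_necessary b : a^-1 < b -> (moment b < +oo)%E.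
Proof.
move=> ab; have [//|moo] := momentP b.
have b0 : 0 < b by rewrite (lt_trans _ ab)// invr_gt0.
have := limn_esup_lower_bound iidX a0 b0 moo => h.
case: (@ae_not_false _ _ _ P); apply: filterS2 HL h => w; rewrite -/(L w) => ->.
by rewrite lee_fin ler_expR leNgt ab.
Qed.

(** With [b = 1/a + 1], both [S n - n E X] and, by the value of the limit
    superior, [S n] are [O(n^(1/a) (ln n)^(b + 1))], which leaves no drift. *)
Lemma centered_necessary : centered.
Proof.
move=> a1; pose b := a^-1 + 1; have ab : a^-1 < b by rewrite ltrDl.
have b0 : 0 < b by rewrite (lt_trans _ ab)// invr_gt0.
have mb := moment_fin_necessary ab.
have XI := moment_integrable a1 (ltW b0) mb.
split=> //; set E := (\int[P]_w _)%E.
have EE : E = (fine E)%:E by rewrite fineK//; exact: integrable_fin_num.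
rewrite EE; congr (_%:E); apply: contrapT => c0.
have [linI linE] : P.-integrable [set: T] (fun w => (linear_part a (X 0 w))%:E) /\
    (\int[P]_w (linear_part a (X 0 w))%:E = (fine E)%:E)%E.
  by apply: linear_part_mean => [_|]; [rewrite -EE|rewrite leNgt a1].
have := partial_sum_upper_bound iidX a0 a2 (ltW b0) mb linI linE ltr01 => h.
case: (@ae_not_false _ _ _ P); apply: filterS2 HL h => w Lw hw; apply: c0.
have b1 : 0 < b + 1 by lra.
have : (L w < (expR (b + 1))%:E)%E by rewrite Lw lte_fin ltr_expR /b; lra.
move=> /(limn_esup_rate_lt b1)[b' /andP[_ b'b] hb'].
apply: (near_drift_eq0 a1 (ltW b1) _ hw).
near=> n; apply: (@le_trans _ _ (n%:R `^ a^-1 * ln n%:R `^ b')); first by near: n.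
rewrite ler_wpM2l ?powR_ge0// ler_powR ?(ltW b'b)//.
by near: n; exact: near_ln_ge.
Unshelve. all: by end_near. Qed.

(** A finite moment below [1/a] contradicts the upper bound, which applies to
    nonnegative exponents and to centred summands; hence the maximum with [0],
    which stays below [1/a], and the use of [centered_necessary]. *)
Lemma moment_infty_necessary b : b < a^-1 -> moment b = +oo%E.
Proof.
move=> ba; have [mb|//] := momentP b.
pose b1 := Num.max b 0; pose e := (a^-1 - b1) / 2.
have b1a : b1 < a^-1 by rewrite gt_max ba invr_gt0.
have e0 : 0 < e by rewrite divr_gt0// subr_gt0.
have b10 : 0 <= b1 by rewrite le_max lexx orbT.
have mb1 : (moment b1 < +oo)%E.
  by apply: le_moment_fin mb => //; rewrite le_max lexx.
have := upper b10 e0 centered_necessary mb1 => h.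
case: (@ae_not_false _ _ _ P); apply: filterS2 HL h => w ->.
rewrite lee_fin ler_expR leNgt => /negP; apply.
by rewrite /e; lra.
Qed.

End Criterion.

(* The generic variable is [X 0]; the summands are [X 1], [X 2], and so on. *)
Theorem mainTheorem7 (R : realType) (d : measure_display)
    (T : measurableType d) (P : probability T R)
    (alpha : R) (halpha0 : 0 < alpha) (halpha2 : alpha <= 2)
    (X : nat -> {RV P >-> R}) (hX : iid X) :
  {ae P, forall w : T,
     limn_esup (fun n : nat =>
       (`| partial_sum X n w / n%:R `^ alpha^-1 | `^ (ln (ln n%:R))^-1)%:E)
     = (expR alpha^-1)%:E}
  <->
  (ereal_inf [set b%:E | b in
      [set b : R |
        ('E_P[(fun w : T =>
                 (`|X 0%N w| `^ alpha) / (Llog `|X 0%N w| `^ (b * alpha)))%R]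
         < +oo)%E]]
   = (alpha^-1)%:E
   /\ (1 < alpha ->
         P.-integrable [set: T] (EFin \o X 0%N) /\ ('E_P[X 0%N] = 0)%E)).
Proof.
have momentE b : ('E_P[(fun w : T =>
    (`|X 0%N w| `^ alpha) / (Llog `|X 0%N w| `^ (b * alpha)))%R] =
    \int[P]_w (phi alpha b `|X 0 w|)%:E)%E by rewrite unlock.
have meanE : ('E_P[X 0%N] = \int[P]_w (X 0 w)%:E)%E by rewrite unlock.
rewrite meanE; set I := ereal_inf _.
split=> [H|[IE hc]].
- split; last exact: (centered_necessary hX halpha0 halpha2 H).
  apply/eqP; rewrite eq_le; apply/andP; split.
    apply/lee_addgt0Pr => e e0; apply: ereal_inf_lbound.
    exists (alpha^-1 + e) => //=; rewrite momentE.
    by apply: (moment_fin_necessary hX halpha0 H); rewrite ltrDl.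
  apply: le_ereal_inf_tmp => _ [b /= + <-]; rewrite momentE lee_fin => mb.
  rewrite leNgt; apply/negP => ba; move: mb.
  by rewrite (moment_infty_necessary hX halpha0 halpha2 H ba).
- apply: (limn_esup_sufficient hX halpha0 halpha2 hc) => [b ab|b b0 ba].
    have : (I < b%:E)%E by rewrite IE lte_fin.
    move=> /ereal_inf_lt[_ [b1 /= + <-]]; rewrite momentE lte_fin => mb /ltW bb.
    exact: le_moment_fin bb mb.
  apply/eqP; rewrite -leye_eq leNgt; apply/negP => mb.
  have : (I <= b%:E)%E by apply: ereal_inf_lbound; exists b => //=; rewrite momentE.
  by rewrite IE lee_fin leNgt ba.
Qed.
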